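(* Consider the It\^o system $$dx(t)=[A(t)x(t)+B(t)u(t)]dt+[\bar A(t)x(t)+\bar B(t)u(t)]dw(t),\quad x(t_0)=x_0,$$ with state $x\in\mathbb R^n$, control $u\in\mathbb R^m$, and the cost $$J(t_0,x_0;u)=E\int_{t_0}^T[x'(t)Q(t)x(t)+u'(t)R(t)u(t)]dt+E\,x'(T)Hx(T),$$ with $Q(t),R(t),H$ symmetric, to be minimized over $u\in\mathcal U[t_0,T]$. Assume convexity: $J(t_0,0;u)\ge 0$ for all $u\in\mathcal U[t_0,T]$. Suppose there exists a symmetric matrix $P_1(T)\in\mathbb R^{n\times n}$ such that, with $P(t)$, $P_1(t)$ and the other notation as in the context: (a) the following hold on $[t_0,T]$: (i) $L'(t)=L'(t)[I-P_1(t)\bar F_0(t)]^{\dagger}[I-P_1(t)\bar F_0(t)]$ for $L=B$, $\bar A$, $\bar B$; (ii) $[\Upsilon_0(t)+\bar B'(t)P_1(t)\bar B(t)]^{\dagger}L'(t)=\{I-\Upsilon_0^{\dagger}(t)\bar B'(t)[I-P_1(t)\bar F_0(t)]^{\dagger}P_1(t)\bar B(t)\}\Upsilon_0^{\dagger}(t)L'(t)$ for $L=B$, $\bar B$; (iii) $0=\bar B_0'(t)[I-P_1(t)\bar F_0(t)]^{\dagger}P_1(t)\bar B_0(t)$; (b) the changed cost $\bar J(t_0,x_0;u)=J(t_0,x_0;u)+E\{x'(T)P_1(T)x(T)\}$ is regular (in the sense defined in the context); (c) $P_1(T)x(T)=0$ can be achieved with the controller minimizing $\bar J$. Then the optimal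 controller (minimizing $J$) is given by $$u(t)=-\bar\Upsilon^{\dagger}(t)\bar\Gamma(t)x(t)+[I-\bar\Upsilon^{\dagger}(t)\bar\Upsilon(t)]z(t),$$ where $z(t)\in\mathbb R^m$ is an arbitrary vector such that $P_1(T)x(T)=0$, and the optimal cost is $$J^*=x_0'\bar P(t_0)x_0 .$$
   Context: $'$ denotes transpose, $M^{\dagger}$ the Moore-Penrose inverse. $w$ is a standard one-dimensional Brownian motion, $\mathcal F_t=\sigma\{w(s):t_0\le s\le t\}$; $A(t),B(t),\bar A(t),\bar B(t)$ are deterministic matrices of compatible dimensions. Admissible controls: $\mathcal U[t_0,T]=\{u: u(t)\ \mathcal F_t\text{-adapted},\ E\int_{t_0}^T\|u(t)\|^2dt<\infty\}$. $P(t)$ is the symmetric solution of $$0=\dot P+A'P+PA+\bar A'P\bar A+Q-\Gamma_0'\Upsilon_0^{\dagger}\Gamma_0,\quad P(T)=H,$$ $$\Upsilon_0=R+\bar B'P\bar B,\qquad \Gamma_0=B'P+\bar B'P\bar A .$$ Let $\mathrm{rank}\,\Upsilon_0(t)=m_0<m$. $T_0(t)$ is an (invertible) elementary row transformation matrix with $T_0[I-\Upsilon_0^{\dagger}\Upsilon_0]=\begin{bmatrix}0\\ \Upsilon_{T_0}\end{bmatrix}$, $\Upsilon_{T_0}(t)\in\mathbb R^{(m-m_0)\times m}$ of full row rank. $\bar B_0(t)\in\mathbb R^{n\times(m-m_0)}$ is the block of last $m-m_0$ columns in $$\begin{bmatrix}\ast&\bar B_0\end{bmatrix}=\bar B[I-\Upsilon_0^{\dagger}\Upsilon_0]T_0^{-1}.$$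 Furthermore $$A_0=A-B\Upsilon_0^{\dagger}\Gamma_0,\quad \bar A_0=\bar A-\bar B\Upsilon_0^{\dagger}\Gamma_0,\quad D_0=-B\Upsilon_0^{\dagger}B',\quad \bar D_0=-\bar B\Upsilon_0^{\dagger}B',$$ $$F_0=-B\Upsilon_0^{\dagger}\bar B',\quad \bar F_0=-\bar B\Upsilon_0^{\dagger}\bar B'.$$ Given the terminal value $P_1(T)$, $P_1(t)$ is the symmetric solution of $$0=\dot P_1+P_1A_0+A_0'P_1+P_1D_0P_1+[\bar A_0'+P_1F_0][I-P_1\bar F_0]^{\dagger}P_1[\bar A_0+\bar D_0P_1].$$ $\bar P(t)$ is the solution of $$0=\dot{\bar P}+A'\bar P+\bar PA+\bar A'\bar P\bar A+Q-\bar\Gamma'\bar\Upsilon^{\dagger}\bar\Gamma,\quad \bar P(T)=H+P_1(T),$$ $$\bar\Upsilon=R+\bar B'\bar P\bar B,\qquad \bar\Gamma=B'\bar P+\bar B'\bar P\bar A.$$ Regularity: the changed cost $\bar J$ is called regular if $\mathrm{Range}[\bar\Gamma(t)]\subseteq\mathrm{Range}[\bar\Upsilon(t)]$, equivalently $[I-\bar\Upsilon(t)\bar\Upsilon^{\dagger}(t)]\bar\Gamma(t)=0$, on $[t_0,T]$. In the conclusion, ''$z(t)$ such that $P_1(T)x(T)=0$'' refers to the state $x$ generated by the system under the stated controller $u\in\mathcal U[t_0,T]$. *)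

(* Defs.v *)
From HB Require Import structures.
From mathcomp Require Import all_boot all_order all_algebra.
From mathcomp Require Import all_classical all_reals all_analysis.
Set Implicit Arguments.
Unset Strict Implicit.
Unset Printing Implicit Defensive.
Import Order.TTheory GRing.Theory Num.Theory numFieldNormedType.Exports.
Local Open Scope classical_set_scope.
Local Open Scope ring_scope.

Section MoorePenrose.
Context {K : realType}.

Definition penrose {p q} (M : 'M[K]_(p, q)) (X : 'M[K]_(q, p)) : Prop :=
  [/\ M *m X *m M = M, X *m M *m X = X,
      (M *m X)^T = M *m X & (X *m M)^T = X *m M].

Definition mpinv {p q} (M : 'M[K]_(p, q)) : 'M[K]_(q, p) :=
  xget 0 [set X | penrose M X].

Lemma mulmx_tr_eq0 p q (M : 'M[K]_(p, q)) : M *m M^T = 0 -> M = 0.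
Proof.
move=> h; apply/matrixP => i j; rewrite mxE.
have /eqP := congr1 (fun Z : 'M[K]_p => Z i i) h.
rewrite !mxE psumr_eq0; last by move=> k _; rewrite mxE -expr2 sqr_ge0.
by move=> /allP/(_ j); rewrite mem_index_enum mxE mulf_eq0 orbb => /(_ isT)/eqP.
Qed.

Lemma gram_unit p q (M : 'M[K]_(p, q)) : row_free M -> M *m M^T \in unitmx.
Proof.
move=> fM; rewrite -row_free_unit -kermx_eq0; apply/eqP.
set Z := kermx _.
have hZ : Z *m (M *m M^T) = 0 by apply: mulmx_ker.
have /mulmx_tr_eq0 : (Z *m M) *m (Z *m M)^T = 0.
  by rewrite trmx_mul mulmxA -(mulmxA Z) hZ mul0mx.
by move=> ZM; apply: (row_free_inj fM); rewrite ZM mul0mx.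
Qed.

Lemma penrose_full_rank p q r (C : 'M[K]_(p, r)) (F : 'M[K]_(r, q)) :
  row_full C -> row_free F ->
  penrose (C *m F) (F^T *m invmx (F *m F^T) *m invmx (C^T *m C) *m C^T).
Proof.
move=> fC fF; have uF : F *m F^T \in unitmx by exact: gram_unit.
have uC : C^T *m C \in unitmx.
  by rewrite -{2}(trmxK C); apply: gram_unit; rewrite /row_free mxrank_tr.
set X := _ *m C^T.
have MX : C *m F *m X = C *m invmx (C^T *m C) *m C^T.
  by rewrite /X !mulmxA -(mulmxA C F) mulmxK.
have XM : X *m (C *m F) = F^T *m invmx (F *m F^T) *m F.
  by rewrite /X !mulmxA -(mulmxA _ C^T C) mulmxKV.
split.
- by rewrite MX !mulmxA -(mulmxA _ C^T C) mulmxKV.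
- by rewrite XM /X !mulmxA -(mulmxA _ F F^T) mulmxKV.
- by rewrite MX !trmx_mul trmx_inv trmx_mul !trmxK !mulmxA.
- by rewrite XM !trmx_mul trmx_inv trmx_mul !trmxK !mulmxA.
Qed.

Lemma penrose_ex p q (M : 'M[K]_(p, q)) : exists X, penrose M X.
Proof.
have := penrose_full_rank (col_base_full M) (row_base_free M).
by rewrite mulmx_base => MX; eexists; exact: MX.
Qed.

Lemma penrose_unique p q (M : 'M[K]_(p, q)) X Y :
  penrose M X -> penrose M Y -> X = Y.
Proof.
move=> [x1 x2 x3 x4] [y1 y2 y3 y4].
have MXY : M *m X = M *m Y.
  have e : M *m Y *m (M *m X) = M *m X by rewrite mulmxA y1.
  by rewrite -x3 -e trmx_mul x3 y3 mulmxA x1.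
have XYM : X *m M = Y *m M.
  have e : X *m M *m (Y *m M) = X *m M by rewrite -mulmxA (mulmxA M) y1.
  by rewrite -x4 -e trmx_mul x4 y4 -mulmxA (mulmxA M) x1.
by rewrite -x2 XYM -mulmxA MXY mulmxA y2.
Qed.

Lemma mpinvP p q (M : 'M[K]_(p, q)) : penrose M (mpinv M).
Proof. by have [X MX] := penrose_ex M; exact: (xgetPex 0 (ex_intro _ X MX)). Qed.

End MoorePenrose.

Section Processes.
Context {K : realType} {d : measure_display} {Omega : measurableType d}.
Variables (Pr : probability Omega K) (w : K -> Omega -> K) (t0 T : K).
Local Notation mu := (@lebesgue_measure K).

(* sigma{w(r) : a <= r <= t}, not augmented by null sets. *)
Definition natural_filtration (a t : K) : set (set Omega) :=
  <<s [set E | exists2 r, a <= r <= t &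
               exists2 B, measurable B & E = w r @^-1` B] >>.

Definition measurable_wrt (G : set (set Omega)) (X : Omega -> K) : Prop :=
  forall B, measurable B -> G (X @^-1` B).

Definition increment (s t : K) (om : Omega) : K := w t om - w s om.

(* The second parameter of [normal_prob] is the standard deviation. *)
Record brownian_motion : Prop := BrownianMotion {
  bm_measurable : forall t : K, 0 <= t -> measurable_fun setT (w t);
  bm_start : {ae Pr, forall om, w 0 om = 0};
  bm_continuous :
    {ae Pr, forall om, {within `[0, +oo[, continuous (fun t => w t om)}};
  bm_gaussian : forall (s t : K) (B : set K), 0 <= s -> s < t -> measurable B ->
    Pr (increment s t @^-1` B) =
    normal_prob 0 (Num.sqrt (t - s)) B;
  bm_independent : forall (s t : K) E (B : set K), 0 <= s -> s < t ->
    natural_filtration 0 s E -> measurable B ->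
    Pr (E `&` increment s t @^-1` B) =
    (Pr E * Pr (increment s t @^-1` B))%E }.

(* A finite sum of processes xi 1_]a, b], with intervals that may overlap, so
   that concatenation gives the sum of two such processes. *)
Record step_process := StepProcess {
  sp_size : nat;
  sp_left : nat -> K;
  sp_right : nat -> K;
  sp_val : nat -> Omega -> K }.

Definition simple_process (g : step_process) : Prop :=
  forall i, (i < sp_size g)%N ->
    [/\ t0 <= sp_left g i, sp_left g i <= sp_right g i, sp_right g i <= T,
        measurable_wrt (natural_filtration t0 (sp_left g i)) (sp_val g i) &
        exists c, forall om, `|sp_val g i om| <= c].

Definition sp_eval (g : step_process) (s : K) (om : Omega) : K :=
  \sum_(i < sp_size g)
    sp_val g i om * (sp_left g i < s <= sp_right g i)%R%:R.

Definition sp_integral (g : step_process) (t : K) (om : Omega) : K :=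
  \sum_(i < sp_size g) sp_val g i om *
    increment (Num.min t (sp_left g i)) (Num.min t (sp_right g i)) om.

(* [I] is (a version of) the Ito integral of [f] against [w] over [t0, t]. *)
Definition ito_integral (t : K) (f : K -> Omega -> K) (I : Omega -> K) : Prop :=
  measurable_fun setT I /\
  exists g : nat -> step_process,
  [/\ forall k, simple_process (g k),
      (fun k => \int[Pr]_om \int[mu]_(s in `[t0, t])
         ((f s om - sp_eval (g k) s om) ^+ 2)%:E)%E @ \oo --> 0%E &
      (fun k => \int[Pr]_om ((I om - sp_integral (g k) t om) ^+ 2)%:E)%E
         @ \oo --> 0%E].

Definition sqnorm {p} (v : 'cV[K]_p) : K := (v^T *m v) 0 0.
Definition quad {p} (M : 'M[K]_p) (v : 'cV[K]_p) : K := (v^T *m M *m v) 0 0.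

Definition L2_adapted {p} (u : K -> Omega -> 'cV[K]_p) : Prop :=
  [/\ forall i, measurable_fun (`[t0, T] `*` setT)
                  (fun a : K * Omega => u a.1 a.2 i 0),
      forall t i, t0 <= t <= T ->
        measurable_wrt (natural_filtration t0 t) (fun om => u t om i 0) &
      (\int[Pr]_om \int[mu]_(t in `[t0, T]) (sqnorm (u t om))%:E < +oo)%E].

End Processes.

Section LQ.
Context {K : realType} {n m : nat}.

Record lq_data := LQData {
  lqA : K -> 'M[K]_n;
  lqB : K -> 'M[K]_(n, m);
  lqAb : K -> 'M[K]_n;
  lqBb : K -> 'M[K]_(n, m);
  lqQ : K -> 'M[K]_n;
  lqR : K -> 'M[K]_m;
  lqH : 'M[K]_n }.

Variable L : lq_data.
Local Notation A := (lqA L).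
Local Notation B := (lqB L).
Local Notation Ab := (lqAb L).
Local Notation Bb := (lqBb L).
Local Notation Q := (lqQ L).
Local Notation R := (lqR L).

Section Control.
Context {d : measure_display} {Omega : measurableType d}.
Variables (Pr : probability Omega K) (w : K -> Omega -> K) (t0 T : K).
Local Notation mu := (@lebesgue_measure K).

Definition admissible (u : K -> Omega -> 'cV[K]_m) : Prop :=
  L2_adapted Pr w t0 T u.

(* dx = (A x + B u) dt + (Ab x + Bb u) dw, x(t0) = x0, in integral form. *)
Definition state (x0 : 'cV[K]_n) (u : K -> Omega -> 'cV[K]_m)
    (x : K -> Omega -> 'cV[K]_n) : Prop :=
  [/\ L2_adapted Pr w t0 T x,
      {ae Pr, forall om, forall i,
         {within `[t0, T], continuous (fun t => x t om i 0)}} &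
      forall t i, t0 <= t <= T -> exists2 I : Omega -> K,
        ito_integral Pr w t0 T t
          (fun s om => (Ab s *m x s om + Bb s *m u s om) i 0) I &
        {ae Pr, forall om, x t om i 0 = x0 i 0 +
           \int[mu]_(s in `[t0, t]) ((A s *m x s om + B s *m u s om) i 0) +
           I om}].

Definition cost (x : K -> Omega -> 'cV[K]_n) (u : K -> Omega -> 'cV[K]_m) :
    \bar K :=
  ('E_Pr[fun om => (\int[mu]_(t in `[t0, T])
                     (quad (Q t) (x t om) + quad (R t) (u t om)))%R] +
   'E_Pr[fun om => quad (lqH L) (x T om)])%E.

Definition changed_cost (P1T : 'M[K]_n) (x : K -> Omega -> 'cV[K]_n)
    (u : K -> Omega -> 'cV[K]_m) : \bar K :=
  (cost x u + 'E_Pr[fun om => quad P1T (x T om)])%E.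

Definition minimizes (J : (K -> Omega -> 'cV[K]_n) ->
    (K -> Omega -> 'cV[K]_m) -> \bar K) (x0 : 'cV[K]_n)
    (x : K -> Omega -> 'cV[K]_n) (u : K -> Omega -> 'cV[K]_m) : Prop :=
  [/\ admissible u, state x0 u x &
      forall v y, admissible v -> state x0 v y -> (J x u <= J y v)%E].

Definition optimal_cost (x0 : 'cV[K]_n) : \bar K :=
  ereal_inf [set c | exists u x,
    [/\ admissible u, state x0 u x & c = cost x u]].

End Control.

Section Riccati.
Variable P : K -> 'M[K]_n.

Definition Upsilon (t : K) : 'M[K]_m := R t + (Bb t)^T *m P t *m Bb t.

Definition Gamma (t : K) : 'M[K]_(m, n) :=
  (B t)^T *m P t + (Bb t)^T *m P t *m Ab t.

Definition riccati (t : K) : 'M[K]_n :=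
  (A t)^T *m P t + P t *m A t + (Ab t)^T *m P t *m Ab t + Q t -
  (Gamma t)^T *m mpinv (Upsilon t) *m Gamma t.

(* Range Gamma <= Range Upsilon: [<=]%MS compares row spaces. *)
Definition regular (t0 T : K) : Prop :=
  forall t, t0 <= t <= T ->
  ((Gamma t)^T <= (Upsilon t)^T)%MS.

Definition null_proj (t : K) : 'M[K]_m :=
  1%:M - mpinv (Upsilon t) *m Upsilon t.

Definition feedback_form {d} {Omega : measurableType d}
    (Pr : probability Omega K) (t0 T : K) (x : K -> Omega -> 'cV[K]_n)
    (z u : K -> Omega -> 'cV[K]_m) : Prop :=
  forall t, t0 <= t <= T -> {ae Pr, forall om,
    u t om = - (mpinv (Upsilon t) *m Gamma t *m x t om) +
             null_proj t *m z t om}.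

Definition A0 t := A t - B t *m mpinv (Upsilon t) *m Gamma t.
Definition Ab0 t := Ab t - Bb t *m mpinv (Upsilon t) *m Gamma t.
Definition D0 t := - (B t *m mpinv (Upsilon t) *m (B t)^T).
Definition Db0 t := - (Bb t *m mpinv (Upsilon t) *m (B t)^T).
Definition F0 t := - (B t *m mpinv (Upsilon t) *m (Bb t)^T).
Definition Fb0 t := - (Bb t *m mpinv (Upsilon t) *m (Bb t)^T).

Definition IP1F (P1 : K -> 'M[K]_n) t : 'M[K]_n := 1%:M - P1 t *m Fb0 t.

Definition riccati1 (P1 : K -> 'M[K]_n) (t : K) : 'M[K]_n :=
  P1 t *m A0 t + (A0 t)^T *m P1 t + P1 t *m D0 t *m P1 t +
  ((Ab0 t)^T + P1 t *m F0 t) *m mpinv (IP1F P1 t) *m P1 t *m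
  (Ab0 t + Db0 t *m P1 t).

End Riccati.

End LQ.
Arguments lq_data : clear implicits.

Section TimeDependentMatrices.
Context {K : realType}.
Variables (t0 T : K).
Local Notation mu := (@lebesgue_measure K).

Definition bounded_measurable {p q} (M : K -> 'M[K]_(p, q)) : Prop :=
  forall i j, measurable_fun `[t0, T] (fun t => M t i j) /\
    exists c, forall t, t0 <= t <= T -> `|M t i j| <= c.

(* 0 = X' + G and X(T) = XT on [t0, T], for absolutely continuous X:
   X(t) = XT + int_t^T G(s) ds entrywise. *)
Definition backward_ode {p} (G : K -> 'M[K]_p) (XT : 'M[K]_p)
    (X : K -> 'M[K]_p) : Prop :=
  (forall i j, mu.-integrable `[t0, T] (fun s => (G s i j)%:E)) /\
  (forall t i j, t0 <= t <= T ->
     X t i j = XT i j + \int[mu]_(s in `[t, T]) G s i j).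

Definition symmetric_on {p} (X : K -> 'M[K]_p) : Prop :=
  forall t, t0 <= t <= T -> (X t)^T = X t.

End TimeDependentMatrices.

Section RowReduction.
Context {K : realType} {n m0 k : nat}.
Variables (L : lq_data K n (m0 + k)) (P : K -> 'M[K]_n).

(* T0 (I - Upsilon0^+ Upsilon0) has m0 zero rows above k independent rows. *)
Definition row_reduction (t : K) (T0 : 'M[K]_(m0 + k)) : Prop :=
  [/\ T0 \in unitmx, usubmx (T0 *m null_proj L P t) = 0 &
      row_free (dsubmx (T0 *m null_proj L P t))].

Definition Bb0 (t : K) (T0 : 'M[K]_(m0 + k)) : 'M[K]_(n, k) :=
  rsubmx (lqBb L t *m null_proj L P t *m invmx T0).

End RowReduction.

(* Main.v *)
(* Let B(x, u; y, v) be the symmetric bilinear form that polarizes the cost and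
   Bbar = B + E[x(T)' P1T y(T)] the one that polarizes the changed cost, with
   Upsilon and Gamma formed from Pbar.  Ito's product rule, in expectation, and
   the Riccati equation for Pbar give, for states x from x0 and y from y0,
     Bbar(x, u; y, v) = x0' Pbar(t0) y0 +
       E int (u + Upsilon^+ Gamma x)' Upsilon (v + Upsilon^+ Gamma y) dt.
   If u has the stated feedback form, regularity makes
   Upsilon (u + Upsilon^+ Gamma x) = Upsilon u + Gamma x vanish, and P1T x(T) = 0
   turns Bbar(x, u; y, v) into B(x, u; y, v); hence B(x, u; y, v) =
   x0' Pbar(t0) x0 for every admissible (y, v) from x0, including (x, u), and
     J(y, v) = J(y - x, v - u) + 2 B(x, u; y, v) - J(x, u)
             = J(y - x, v - u) + x0' Pbar(t0) x0,
   where J(y - x, v - u) >= 0 by convexity, as y - x starts at 0.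

   The product rule is needed only in expectation.  It follows from the Ito
   isometry and the martingale property, which pass to the limit from simple
   processes, where they reduce to the first two moments of Gaussian increments
   that are independent of the past; the drift is handled by Fubini. *)
Require Import Defs.
From HB Require Import structures.
From mathcomp Require Import all_boot all_order all_algebra.
From mathcomp Require Import all_classical all_reals all_analysis.
From mathcomp Require Import measurable_realfun.
From mathcomp Require Import ring lra.
Import Order.TTheory GRing.Theory Num.Theory numFieldNormedType.Exports.
Set Implicit Arguments.
Unset Strict Implicit.
Unset Printing Implicit Defensive.
Local Open Scope classical_set_scope.
Local Open Scope ring_scope.

(** * Square-integrable functions *)

(** The Ito integral at each time is a separate random variable with its own approximating sequence,
    so no process t |-> I(t) is at hand. Comparing times s < t takes one sequence that serves both:
    by the isometry, the sequence chosen for t converges at s as well. Where the martingale part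
    occurs under a time integral, it is rewritten as Y - y0 - (primitive of the drift), whose terms
    are jointly measurable.

    P never meets a stochastic integral. The product rule is applied to single coordinates and shows
    that each second moment E[x_i y_j] is a primitive of an integrable function; its product with
    P_ij is then integrated by parts deterministically. This fits coefficients that are merely
    bounded and measurable and a P that is merely absolutely continuous.

    The sign of Upsilon is unknown, so the completed square cannot be estimated. It is therefore
    paired with a second, arbitrary control, where one stationary factor makes it vanish
    identically. *)

Section SquareIntegrable.
Context d (D : measurableType d) (K : realType).
Variable mu : {measure set D -> \bar K}.
Implicit Types f g h : D -> K.

(** Integrals are real numbers, the [fine] part of extended ones, so additivity holds only under
    integrability; [int1] and [sqint] carry that side condition through the proof. *)
Definition int1 f : Prop := mu.-integrable setT (EFin \o f).

Definition sqint f : Prop := measurable_fun setT f /\ int1 (fun x => f x ^+ 2).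

Lemma int1_meas f : int1 f -> measurable_fun setT f.
Proof. by move/measurable_int/measurable_EFinP. Qed.

Lemma int1_le f g : measurable_fun setT f -> (forall x, `|f x| <= `|g x|) ->
  int1 g -> int1 f.
Proof.
move=> mf fg; apply: le_integrable => //; first exact/measurable_EFinP.
by move=> x _; rewrite /= lee_fin.
Qed.

Lemma int1D f g : int1 f -> int1 g -> int1 (fun x => f x + g x).
Proof. by move=> hf hg; exact: (integrableD measurableT hf hg). Qed.

Lemma int1N f : int1 f -> int1 (fun x => - f x).
Proof. by move=> hf; exact: (integrableN hf). Qed.

Lemma int1B f g : int1 f -> int1 g -> int1 (fun x => f x - g x).
Proof. by move=> hf hg; exact: (integrableB measurableT hf hg). Qed.

Lemma int1Z c f : int1 f -> int1 (fun x => c * f x).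
Proof. by move=> hf; exact: (integrableZl measurableT c hf). Qed.

Lemma int1_0 : int1 (fun=> 0).
Proof. exact: integrable0. Qed.

Lemma eq_int1 f g : f =1 g -> int1 f -> int1 g.
Proof. by move=> /funext ->. Qed.

Lemma int1_sum (I : Type) (s : seq I) (F : I -> D -> K) :
  (forall i, int1 (F i)) -> int1 (fun x => \sum_(i <- s) F i x).
Proof.
move=> hF; elim: s => [|i s ih].
  by apply: eq_int1 int1_0 => x; rewrite big_nil.
by apply: eq_int1 (int1D (hF i) ih) => x; rewrite big_cons.
Qed.

Lemma RintD f g : int1 f -> int1 g ->
  \int[mu]_x (f x + g x) = \int[mu]_x f x + \int[mu]_x g x.
Proof. by move=> hf hg; rewrite RintegralD. Qed.

Lemma RintB f g : int1 f -> int1 g ->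
  \int[mu]_x (f x - g x) = \int[mu]_x f x - \int[mu]_x g x.
Proof. by move=> hf hg; rewrite RintegralB. Qed.

Lemma RintZ c f : int1 f -> \int[mu]_x (c * f x) = c * \int[mu]_x f x.
Proof. by move=> hf; rewrite RintegralZl. Qed.

Lemma Rint0 : \int[mu]_x (0 : K) = 0.
Proof. by rewrite /Rintegral integral0. Qed.

Lemma eq_Rint f g : f =1 g -> \int[mu]_x f x = \int[mu]_x g x.
Proof. by move=> fg; apply: eq_Rintegral => x _. Qed.

Lemma Rint_sum (I : Type) (s : seq I) (F : I -> D -> K) :
  (forall i, int1 (F i)) ->
  \int[mu]_x (\sum_(i <- s) F i x) = \sum_(i <- s) \int[mu]_x F i x.
Proof.
move=> hF; elim: s => [|i s ih].
  by rewrite big_nil (eq_Rint (g := fun=> 0)) ?Rint0// => x; rewrite big_nil.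
rewrite big_cons -ih -RintD; [|exact: hF|exact: int1_sum].
by apply: eq_Rint => x; rewrite big_cons.
Qed.

Lemma ae_eq_int1 f g : measurable_fun setT f -> int1 g ->
  {ae mu, forall x, f x = g x} -> int1 f.
Proof.
move=> mf /integrableP[mg ig] fg; apply/integrableP; split.
  exact/measurable_EFinP.
rewrite (_ : (\int[mu]_x _)%E = (\int[mu]_x `|(g x)%:E|)%E)//.
apply: ae_eq_integral => //.
- by apply: measurableT_comp => //; exact/measurable_EFinP.
- by apply: measurableT_comp.
- by apply: filterS fg => x /= -> _.
Qed.

Lemma ae_eq_Rint f g : measurable_fun setT f -> measurable_fun setT g ->
  {ae mu, forall x, f x = g x} -> \int[mu]_x f x = \int[mu]_x g x.
Proof.
move=> mf mg fg; rewrite /Rintegral; congr fine; apply: ae_eq_integral => //.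
- exact/measurable_EFinP.
- exact/measurable_EFinP.
- by apply: filterS fg => x /= -> _.
Qed.

Lemma sqint_mul f g : sqint f -> sqint g -> int1 (fun x => f x * g x).
Proof.
move=> [mf if2] [mg ig2]; apply: int1_le (int1D if2 ig2).
  exact: measurable_funM.
move=> x; rewrite (ger0_norm (addr_ge0 (sqr_ge0 _) (sqr_ge0 _))) normrM.
rewrite -(real_normK (num_real (f x))) -(real_normK (num_real (g x))).
have := sqr_ge0 (`|f x| - `|g x|); have := normr_ge0 (f x).
by have := normr_ge0 (g x); nra.
Qed.

Lemma sqintD f g : sqint f -> sqint g -> sqint (fun x => f x + g x).
Proof.
move=> sf sg; split; first by apply: measurable_funD; [case: sf|case: sg].
have h := int1D (int1D sf.2 (int1Z 2 (sqint_mul sf sg))) sg.2.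
by apply: eq_int1 h => x; ring.
Qed.

Lemma sqintZ c f : sqint f -> sqint (fun x => c * f x).
Proof.
move=> sf; split; first by apply: measurable_funM => //; case: sf.
by apply: eq_int1 (int1Z (c ^+ 2) sf.2) => x; rewrite exprMn.
Qed.

Lemma sqintB f g : sqint f -> sqint g -> sqint (fun x => f x - g x).
Proof.
move=> sf sg; rewrite (_ : (fun x => _) = (fun x => f x + -1 * g x)).
  exact/sqintD/sqintZ.
by apply/funext => x; rewrite mulN1r.
Qed.

Lemma sqint0 : sqint (fun=> 0).
Proof.
split; first exact: measurable_cst.
by apply: eq_int1 int1_0 => x; rewrite expr0n.
Qed.

Lemma sqint_sum (I : Type) (s : seq I) (F : I -> D -> K) :
  (forall i, sqint (F i)) -> sqint (fun x => \sum_(i <- s) F i x).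
Proof.
move=> hF; elim: s => [|i s ih].
  rewrite (_ : (fun x => _) = (fun=> 0)); first exact: sqint0.
  by apply/funext => x; rewrite big_nil.
rewrite (_ : (fun x => _) = (fun x => F i x + \sum_(i <- s) F i x)).
  exact: sqintD.
by apply/funext => x; rewrite big_cons.
Qed.

Lemma sqint_le f g : measurable_fun setT f -> (forall x, `|f x| <= `|g x|) ->
  sqint g -> sqint f.
Proof.
move=> mf fg [mg ig]; split=> //; apply: int1_le ig.
  exact: measurable_funX.
move=> x; rewrite !normrX ler_pXn2r// nnegrE//.
Qed.

Lemma sqint_bounded_mul c f g : measurable_fun setT f ->
  (forall x, `|f x| <= c) -> sqint g -> sqint (fun x => f x * g x).
Proof.
move=> mf fc sg; apply: sqint_le (sqintZ c sg).
  by apply: measurable_funM => //; case: sg.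
by move=> x; rewrite !normrM ler_wpM2r// (le_trans (fc x)) ?ler_norm.
Qed.

Lemma ae_eq_sqint f g : measurable_fun setT f -> sqint g ->
  {ae mu, forall x, f x = g x} -> sqint f.
Proof.
move=> mf [mg ig] fg; split => //; apply: ae_eq_int1 ig _.
  exact: measurable_funX.
by apply: filterS fg => x /= ->.
Qed.

Lemma Rint_sq_ge0 f : 0 <= \int[mu]_x f x ^+ 2.
Proof. by apply: Rintegral_ge0 => x _; exact: sqr_ge0. Qed.

(** The scalar [s] serves the discriminant argument for Cauchy-Schwarz; with s = 1 the same formula
    expands an L2 distance. *)
Lemma Rint_quad f g s : sqint f -> sqint g ->
  \int[mu]_x (s * f x - g x) ^+ 2 =
  s ^+ 2 * \int[mu]_x f x ^+ 2 - 2 * s * (\int[mu]_x (f x * g x))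
  + \int[mu]_x g x ^+ 2.
Proof.
move=> sf sg.
rewrite (eq_Rint (g := fun x => (s ^+ 2 * f x ^+ 2 - (2 * s) * (f x * g x))
  + g x ^+ 2)); last by move=> x; ring.
have i1 := int1Z (s ^+ 2) sf.2; have i2 := int1Z (2 * s) (sqint_mul sf sg).
rewrite RintD; [|exact: int1B|exact: sg.2].
by rewrite RintB// !RintZ//; [exact: sqint_mul|exact: sf.2].
Qed.

Lemma Rint_cauchy_schwarz f g : sqint f -> sqint g ->
  (\int[mu]_x (f x * g x)) ^+ 2 <= (\int[mu]_x f x ^+ 2) * \int[mu]_x g x ^+ 2.
Proof.
move=> sf sg.
set A := \int[mu]_x f x ^+ 2; set C := \int[mu]_x (_ * _).
set B := \int[mu]_x g x ^+ 2.
have A0 : 0 <= A by exact: Rint_sq_ge0.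
have B0 : 0 <= B by exact: Rint_sq_ge0.
have q s : 0 <= s ^+ 2 * A - 2 * s * C + B by rewrite -Rint_quad// Rint_sq_ge0.
have [/eqP A00|An0] := boolP (A == 0).
  have [/eqP C0|Cn0] := boolP (C == 0).
    by rewrite C0 expr0n mulr_ge0.
  (* For A = 0 the nonnegative quadratic is affine in s, and with C nonzero this s would give it the
     value -1. *)
  have := q ((B + 1) / (2 * C)).
  rewrite A00 mulr0 add0r (_ : - _ + B = -1) ?ler0N1//.
  by field.
have Ap : 0 < A by rewrite lt_neqAle eq_sym An0.
(* The minimizer of the quadratic; the minimum is (A B - C^2) / A. *)
have := q (C / A).
rewrite (_ : _ + B = (A * B - C ^+ 2) / A); last by field.
by rewrite pmulr_lge0 ?invr_gt0// subr_ge0.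
Qed.

Lemma Rint_mul_le f g : sqint f -> sqint g ->
  `|\int[mu]_x (f x * g x)| <=
  Num.sqrt ((\int[mu]_x f x ^+ 2) * \int[mu]_x g x ^+ 2).
Proof.
move=> sf sg; rewrite -sqrtr_sqr ler_wsqrtr//.
exact: Rint_cauchy_schwarz.
Qed.

Lemma Rint_mul_cvg (u v : nat -> D -> K) f g :
  (forall k, sqint (u k)) -> (forall k, sqint (v k)) -> sqint f -> sqint g ->
  (fun k => \int[mu]_x (u k x - f x) ^+ 2) @ \oo --> (0 : K) ->
  (fun k => \int[mu]_x (v k x - g x) ^+ 2) @ \oo --> (0 : K) ->
  (fun k => \int[mu]_x (u k x * v k x)) @ \oo --> \int[mu]_x (f x * g x).
Proof.
move=> su sv sf sg uf vg.
set a := fun k => \int[mu]_x (u k x - f x) ^+ 2 in uf.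
set b := fun k => \int[mu]_x (v k x - g x) ^+ 2 in vg.
set A := \int[mu]_x f x ^+ 2; set B := \int[mu]_x g x ^+ 2.
(* Cauchy-Schwarz bounds of the three terms of u v - f g = (u - f)(v - g) + (u - f) g + f (v -
   g). *)
pose e k := Num.sqrt (a k * b k) + Num.sqrt (a k * B) + Num.sqrt (A * b k).
have e0 : e @ \oo --> (0 : K).
  rewrite -[X in _ --> X](_ : Num.sqrt (0 * 0) + Num.sqrt (0 * B) +
    Num.sqrt (A * 0) = 0 :> K); last by rewrite !mul0r mulr0 !sqrtr0 !addr0.
  by apply: cvgD; [apply: cvgD|]; apply: continuous_cvg;
    (try exact: sqrt_continuous); apply: cvgM => //; exact: cvg_cst.
apply: cvg_sub0 (cvg_cst _).
apply/norm_cvg0P; apply: (squeeze_cvgr _ (cvg_cst 0) e0).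
apply: nearW => k; rewrite normr_ge0 /=.
have s1 := sqintB (su k) sf; have s2 := sqintB (sv k) sg.
rewrite /= -[leLHS]/(`|\int[mu]_x (u k x * v k x) - \int[mu]_x (f x * g x)|).
rewrite -RintB; [|exact: sqint_mul|exact: sqint_mul].
rewrite (eq_Rint (g := fun x => (u k x - f x) * (v k x - g x) +
  (u k x - f x) * g x + f x * (v k x - g x))); last by move=> x; ring.
have i1 := sqint_mul s1 s2; have i2 := sqint_mul s1 sg.
have i3 := sqint_mul sf s2.
rewrite RintD; [|exact: int1D|exact: i3]; rewrite RintD//.
rewrite (le_trans (ler_normD _ _))// lerD//; last exact: Rint_mul_le.
by rewrite (le_trans (ler_normD _ _))// lerD//; exact: Rint_mul_le.
Qed.

Lemma sqint_near (u : nat -> D -> K) f : measurable_fun setT f ->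
  (forall k, sqint (u k)) ->
  (fun k => \int[mu]_x ((f x - u k x) ^+ 2)%:E)%E @ \oo --> 0%E -> sqint f.
Proof.
(* Convergence to 0 in the extended reals makes the distance finite from some N on, and f = (f - u
   N) + u N. *)
move=> mf su /fine_cvgP[[N _ /(_ N (leqnn N))]] fin _.
suff : sqint (fun x => f x - u N x).
  move=> /sqintD /(_ (su N)); rewrite (_ : (fun x => _) = f)//.
  by apply/funext => x; rewrite subrK.
have mfu : measurable_fun setT (fun x => f x - u N x).
  by apply: measurable_funB => //; exact: (su N).1.
split => //; apply/integrableP; split.
  by apply/measurable_EFinP; exact: measurable_funX.
rewrite (eq_integral (fun x => ((f x - u N x) ^+ 2)%:E)); last first.
  by move=> x _; rewrite /= ger0_norm// sqr_ge0.
move: fin => /=; rewrite ge0_fin_numE// integral_ge0// => x _.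
by rewrite lee_fin sqr_ge0.
Qed.

End SquareIntegrable.

(** * Fubini for real-valued integrals *)

Section RealFubini.
Context d1 d2 (D1 : measurableType d1) (D2 : measurableType d2) (K : realType).
Variables (m1 : {sigma_finite_measure set D1 -> \bar K})
  (m2 : {sigma_finite_measure set D2 -> \bar K}).
Local Notation m12 := (m1 \x m2)%E.
Implicit Types (h : D1 * D2 -> K) (f : D1 -> K) (g : D2 -> K).

(** An inner integral may be infinite on a null set, where [fine] replaces it by 0; this affects
    neither integrability nor the value of the outer integral. *)
Lemma int1_fine d (D : measurableType d) (m : {measure set D -> \bar K})
    (F : D -> \bar K) : m.-integrable setT F ->
  int1 m (fun x => fine (F x)) /\ \int[m]_x fine (F x) = fine (\int[m]_x F x)%E.
Proof.
move=> iF; have mF := measurable_int _ iF.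
have mfF : measurable_fun setT (fun x => fine (F x)) by exact: measurableT_comp.
split.
  apply: le_integrable iF => //; first exact/measurable_EFinP.
  by move=> x _; rewrite /=; case: (F x) => [r| |] //=; rewrite leey.
congr fine; apply: ae_eq_integral => //; first exact/measurable_EFinP.
have := integrable_ae measurableT iF; apply: filterS => x /= /(_ I) fx _.
by rewrite fineK.
Qed.

Lemma Rint_fubini1 h : int1 m12 h ->
  int1 m1 (fun x => \int[m2]_y h (x, y)) /\
  \int[m1]_x \int[m2]_y h (x, y) = \int[m12]_z h z.
Proof.
move=> ih; have iF := integrable_fubini_F ih.
have [i1 E1] := int1_fine iF; split => //.
by rewrite /Rintegral -(integral12_prod_meas1 ih).
Qed.

Lemma Rint_fubini2 h : int1 m12 h ->
  int1 m2 (fun y => \int[m1]_x h (x, y)) /\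
  \int[m2]_y \int[m1]_x h (x, y) = \int[m12]_z h z.
Proof.
move=> ih; have mh := measurable_int _ ih.
have iG : m2.-integrable setT (fubini_G m1 (EFin \o h)).
  apply/integrableP; split; first exact: (measurable_fubini_G ih).
  apply: le_lt_trans ((integrable21ltyP _ _ mh).1 ih).
  apply: ge0_le_integral => //.
  - by apply: measurableT_comp => //; exact: (measurable_fubini_G ih).
  - apply: (measurable_fun_fubini_tonelli_G (abse \o (EFin \o h))).
      exact: measurableT_comp.
    by move=> z; exact: abse_ge0.
  - move=> y _; apply: le_abse_integral => //.
    exact: measurableT_comp (pair2_measurable y).
have [i1 E1] := int1_fine iG; split => //.
by rewrite /Rintegral -(integral21_prod_meas1 ih).
Qed.

Lemma int1_ae_section1 h : int1 m12 h ->
  {ae m1, forall x, int1 m2 (fun y => h (x, y))}.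
Proof. exact: ae_integrable1. Qed.

Lemma int1_ae_section2 h : int1 m12 h ->
  {ae m2, forall y, int1 m1 (fun x => h (x, y))}.
Proof. exact: ae_integrable2. Qed.

Lemma Rint_tensor f g : int1 m1 f -> int1 m2 g ->
  int1 m12 (fun z => f z.1 * g z.2) /\
  \int[m12]_z (f z.1 * g z.2) = (\int[m1]_x f x) * \int[m2]_y g y.
Proof.
move=> hf hg.
have mf := int1_meas hf; have mg := int1_meas hg.
have mfg : measurable_fun setT (fun z : D1 * D2 => f z.1 * g z.2).
  by apply: measurable_funM; apply: measurableT_comp.
have ig : (\int[m2]_y `|(g y)%:E| < +oo)%E by case/integrableP: hg.
have ifg : int1 m12 (fun z => f z.1 * g z.2).
  have mE : measurable_fun setT (EFin \o (fun z : D1 * D2 => f z.1 * g z.2)).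
    exact/measurable_EFinP.
  apply/(integrable12ltyP _ _ mE).
  case/integrableP: hf => _ fi; set c := fine (\int[m2]_y `|(g y)%:E|)%E.
  apply: (@le_lt_trans _ _ (\int[m1]_s (`|(f s)%:E| * c%:E))%E).
    rewrite le_eqVlt; apply/orP; left; apply/eqP; apply: eq_integral => s _.
    rewrite /c fineK ?ge0_fin_numE ?integral_ge0//.
    rewrite -ge0_integralZl//; last first.
      by apply: measurableT_comp => //; exact/measurable_EFinP.
    by apply: eq_integral => om _; rewrite /= -EFinM -normrM.
  have c0 : 0 <= c by rewrite fine_ge0// integral_ge0.
  rewrite ge0_integralZr//.
    by rewrite muleC lte_mul_pinfty ?lee_fin.
  by apply: measurableT_comp => //; exact/measurable_EFinP.
split => //; rewrite -(Rint_fubini1 ifg).2.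
rewrite -[RHS](RintegralZr _ measurableT hf); apply: eq_Rint => x /=.
by rewrite RintZ.
Qed.

End RealFubini.

(** * Integration by parts for primitives of integrable functions *)

Section Primitives.
Context {K : realType}.
Local Notation mu := (@lebesgue_measure K).
Implicit Types (f g : measurableTypeR K -> K) (a b : K).

Lemma int1_restrict f (i : interval K) :
  mu.-integrable [set` i] (EFin \o f) <-> int1 mu (f \_ [set` i]).
Proof.
have mi : measurable ([set` i] : set (measurableTypeR K)) by exact: measurable_itv.
by rewrite (integrable_mkcond _ mi) restrict_EFin.
Qed.

Lemma restrict_mul_le f a b x : x <= b ->
  (fun y => (f \_ `[a, b]) y * (y <= x)%R%:R) = f \_ `[a, x].
Proof.
move=> xb; apply/funext => y; rewrite !patchE !mem_setE !in_itv/=.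
case: (a <= y) => /=; last by rewrite mul0r.
case: (leP y x) => yx; last by rewrite mulr0.
by rewrite (le_trans yx xb) mulr1.
Qed.

Lemma restrict_mul_lt f a b x : x <= b ->
  (fun y => (f \_ `[a, b]) y * (y < x)%R%:R) = f \_ `[a, x[.
Proof.
move=> xb; apply/funext => y; rewrite !patchE !mem_setE !in_itv/=.
case: (a <= y) => /=; last by rewrite mul0r.
case: (ltP y x) => yx; last by rewrite mulr0.
by rewrite (le_trans (ltW yx) xb) mulr1.
Qed.

(* Fubini on [a, b]^2, split along the diagonal. *)
Lemma primitive_mul f g a b :
  mu.-integrable `[a, b] (EFin \o f) -> mu.-integrable `[a, b] (EFin \o g) ->
  let F x := \int[mu]_(y in `[a, x]) f y in
  let G x := \int[mu]_(y in `[a, x]) g y in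
  [/\ mu.-integrable `[a, b] (EFin \o (fun x => f x * G x)),
      mu.-integrable `[a, b] (EFin \o (fun x => F x * g x)) &
      F b * G b = \int[mu]_(x in `[a, b]) (f x * G x) +
                  \int[mu]_(x in `[a, b]) (F x * g x)].
Proof.
move=> fi gi F G.
have mab : measurable (`[a, b]%classic : set (measurableTypeR K)) by [].
have f1 := (int1_restrict f _).1 fi; have g1 := (int1_restrict g _).1 gi.
have [ih Eh] := Rint_tensor f1 g1.
set h := fun z => _ in ih Eh.
have mh := int1_meas ih.
have mb : measurable_fun setT (fun c : bool => c%:R : K) by [].
have mle : measurable_fun setT
    (fun z : measurableTypeR K * measurableTypeR K => (z.2 <= z.1)%R%:R : K).
  by apply: (measurableT_comp mb); exact: measurable_fun_ler.
have mlt : measurable_fun setT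
    (fun z : measurableTypeR K * measurableTypeR K => (z.1 < z.2)%R%:R : K).
  by apply: (measurableT_comp mb); exact: measurable_fun_ltr.
have il : int1 (mu \x mu)%E (fun z => h z * (z.2 <= z.1)%R%:R).
  apply: int1_le ih; first by apply: measurable_funM => //; exact: mh.
  by move=> z; rewrite normrM ler_piMr//; case: (z.2 <= z.1); rewrite ?normr1 ?normr0.
have ir : int1 (mu \x mu)%E (fun z => h z * (z.1 < z.2)%R%:R).
  apply: int1_le ih; first by apply: measurable_funM => //; exact: mh.
  by move=> z; rewrite normrM ler_piMr//; case: (z.1 < z.2); rewrite ?normr1 ?normr0.
have [il1 El] := Rint_fubini1 il.
have [ir1 Er] := Rint_fubini2 ir.
have e1 : (fun x => \int[mu]_y (h (x, y) * (y <= x)%R%:R)) =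
          (fun x => f x * G x) \_ `[a, b].
  apply/funext => x; rewrite patchE.
  transitivity (\int[mu]_y ((f \_ `[a, b]) x * ((g \_ `[a, b]) y * (y <= x)%R%:R))).
    by apply: eq_Rint => y; rewrite /h /= mulrA.
  rewrite patchE; case: ifPn => [|_]; last first.
    by rewrite -[RHS](Rint0 mu); apply: eq_Rint => y; rewrite mul0r.
  rewrite mem_setE in_itv/= => /andP[ax xb].
  transitivity (\int[mu]_y (f x * (g \_ `[a, x]) y)).
    apply: eq_Rint => y; congr (_ * _).
    exact: (congr1 (@^~ y) (restrict_mul_le g a xb)).
  have i1 : mu.-integrable `[a, x] (EFin \o g).
    apply: (integrableS mab _ _ gi) => //.
    by move=> y /=; rewrite !in_itv/= => /andP[-> yx]; exact: le_trans xb.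
  rewrite RintZ; last exact: (int1_restrict _ _).1.
  by rewrite -Rintegral_mkcond.
have e2 : (fun y => \int[mu]_x (h (x, y) * (x < y)%R%:R)) =
          (fun x => F x * g x) \_ `[a, b].
  apply/funext => y; rewrite patchE.
  transitivity (\int[mu]_x ((g \_ `[a, b]) y * ((f \_ `[a, b]) x * (x < y)%R%:R))).
    by apply: eq_Rint => x; rewrite /h /=; ring.
  rewrite patchE; case: ifPn => [|_]; last first.
    by rewrite -[RHS](Rint0 mu); apply: eq_Rint => x; rewrite mul0r.
  rewrite mem_setE in_itv/= => /andP[ay yb].
  have i1 : mu.-integrable `[a, y[ (EFin \o f).
    apply: (integrableS mab _ _ fi) => //.
    by move=> x /=; rewrite !in_itv/= => /andP[-> /ltW xy]; exact: le_trans yb.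
  transitivity (\int[mu]_x (g y * (f \_ `[a, y[) x)).
    apply: eq_Rint => x; congr (_ * _).
    exact: (congr1 (@^~ x) (restrict_mul_lt f a yb)).
  rewrite RintZ; last exact: (int1_restrict _ _).1.
  (* The strict half of the square leaves out the end point y, a null set, while F integrates up to
     it. *)
  by rewrite -Rintegral_mkcond mulrC Rintegral_itv_bndo_bndc.
split.
- by apply: (int1_restrict _ _).2; rewrite -e1.
- by apply: (int1_restrict _ _).2; rewrite -e2.
rewrite [X in _ = X + _]Rintegral_mkcond [X in _ = _ + X]Rintegral_mkcond.
rewrite -e1 -e2 El Er -RintD//.
rewrite -[LHS](_ : \int[(mu \x mu)%E]_z h z = _); last first.
  by rewrite Eh -!Rintegral_mkcond.
apply: eq_Rint => z; rewrite -mulrDr -natrD.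
by case: (leP z.2 z.1) => _; rewrite mulr1.
Qed.

End Primitives.

(** * Independence and Gaussian increments *)

Lemma eq_measure_integrable d (D : measurableType d) (K : realType)
    (m1 m2 : {measure set D -> \bar K}) (h : D -> \bar K) :
  (forall A, measurable A -> m1 A = m2 A) ->
  m1.-integrable setT h -> m2.-integrable setT h.
Proof.
move=> m12 /integrableP[mh ih]; apply/integrableP; split=> //.
by rewrite (eq_measure_integral m1) // => A mA _; rewrite m12.
Qed.

Lemma int1_pushforward d d' (Omega : measurableType d) (D : measurableType d')
    (K : realType) (Pr : {measure set Omega -> \bar K})
    (m : {measure set D -> \bar K}) (X : Omega -> D) (h : D -> K) :
  measurable_fun setT X -> measurable_fun setT h ->
  (forall A, measurable A -> m A = Pr (X @^-1` A)) ->
  int1 m h -> int1 Pr (h \o X).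
Proof.
move=> mX mh mE /integrableP[_ ih]; apply/integrableP; split.
  by apply/measurable_EFinP; exact: measurableT_comp.
rewrite -[X in (X < _)%E](@ge0_integral_pushforward _ _ _ _ _ _ mX Pr setT
   (fun y => `|(h y)%:E|%E))//; last first.
  by apply: measurableT_comp => //; exact/measurable_EFinP.
by rewrite (eq_measure_integral m) // => A mA _; rewrite mE.
Qed.

Lemma Rint_pushforward d d' (Omega : measurableType d) (D : measurableType d')
    (K : realType) (Pr : {measure set Omega -> \bar K})
    (m : {measure set D -> \bar K}) (X : Omega -> D) (h : D -> K) :
  measurable_fun setT X -> measurable_fun setT h ->
  (forall A, measurable A -> m A = Pr (X @^-1` A)) ->
  int1 Pr (h \o X) ->
  int1 m h /\ \int[Pr]_om h (X om) = \int[m]_x h x.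
Proof.
move=> mX mh mE iX.
have mEh : measurable_fun setT (EFin \o h) by exact/measurable_EFinP.
have ih' := integrable_pushforward mX mEh iX measurableT.
split; first by apply: eq_measure_integrable ih' => A mA; rewrite mE.
rewrite /Rintegral -[X in fine X = _](integral_pushforward mX mEh iX measurableT).
by congr fine; apply: eq_measure_integral => A mA _; rewrite mE.
Qed.

Section Independence.
Context d (Omega : measurableType d) (K : realType).
Variable Pr : probability Omega K.
Implicit Types X Y : Omega -> K.

Definition indep X Y : Prop := forall A B : set K, measurable A -> measurable B ->
  Pr (X @^-1` A `&` Y @^-1` B) = (Pr (X @^-1` A) * Pr (Y @^-1` B))%E.

Lemma indep_Rint_mul X Y : measurable_fun setT X -> measurable_fun setT Y ->
  indep X Y -> int1 Pr X -> int1 Pr Y -> int1 Pr (fun om => X om * Y om) ->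
  \int[Pr]_om (X om * Y om) = (\int[Pr]_om X om) * (\int[Pr]_om Y om).
Proof.
move=> mX mY XY iX iY iXY.
pose m1 := distribution Pr
  (HB.pack_for {RV Pr >-> K} X (isMeasurableFun.Build _ _ _ _ _ mX)).
pose m2 := distribution Pr
  (HB.pack_for {RV Pr >-> K} Y (isMeasurableFun.Build _ _ _ _ _ mY)).
have mZ : measurable_fun setT (fun om => (X om, Y om)).
  exact: measurable_fun_pair.
have mh : measurable_fun setT (fun z : K * K => z.1 * z.2).
  by apply: measurable_funM.
(* Independence is the product formula on rectangles, which determines the joint law. *)
have m12 A : measurable A ->
    (m1 \x m2)%E A = Pr ((fun om => (X om, Y om)) @^-1` A).
  exact: (product_measure_unique (m1 := m1) (m2 := m2)
    (m' := pushforward Pr (fun om => (X om, Y om)))).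
have [ih ->] := Rint_pushforward mZ mh m12 iXY.
have [i1 E1] : int1 m1 id /\ \int[Pr]_om X om = \int[m1]_x x.
  exact: (Rint_pushforward (h := id) mX).
have [i2 E2] : int1 m2 id /\ \int[Pr]_om Y om = \int[m2]_x x.
  exact: (Rint_pushforward (h := id) mY).
rewrite /Rintegral -(integral12_prod_meas1 ih) /fubini_F/=.
transitivity (fine (\int[m1]_x (x * \int[m2]_y y)%:E)).
  congr fine; apply: eq_integral => x _.
  rewrite (eq_integral (fun y => (x%:E * y%:E)%E))//.
  rewrite integralZl// EFinM; congr (_ * _)%E.
  by rewrite /Rintegral fineK//; exact: integrable_fin_num i2.
rewrite -/(Rintegral m1 setT (fun x => x * \int[m2]_y y)).
by rewrite RintegralZr// -E1 -E2.
Qed.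

End Independence.

(** * The first two moments of a centred normal law *)

Section NormalMoments.
Variables (K : realType) (s : K).
Hypothesis s0 : 0 < s.
Local Notation mu := (@lebesgue_measure K).
Local Notation p := (normal_pdf 0 s).

Let sn0 : s != 0. Proof. by rewrite gt_eqF. Qed.

Let pE x : p x = normal_peak s * expR (- x ^+ 2 / (s ^+ 2 *+ 2)).
Proof. by rewrite normal_pdfE// /normal_fun subr0. Qed.

Lemma normal_pdf_opp x : p (- x) = p x.
Proof. by rewrite !pE sqrrN. Qed.

(** The change of variables produces a Radon-Nikodym derivative; it agrees with the density almost
    everywhere because both have the same integral over every measurable set. *)
Lemma ge0_integral_normal (f : K -> \bar K) : (forall x, 0 <= f x)%E ->
  measurable_fun setT f ->
  (\int[normal_prob 0%R s]_x f x = \int[mu]_x (f x * (p x)%:E))%E.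
Proof.
move=> f0 mf; have dom := normal_prob_dominates (0 : K) s.
rewrite -(Radon_Nikodym_SigmaFinite.change_of_variables dom)//.
apply: ae_eq_integral => //.
- apply: emeasurable_funM => //; apply: (measurable_int mu).
  exact: Radon_Nikodym_SigmaFinite.f_integrable.
- apply: emeasurable_funM => //; apply/measurable_EFinP.
  exact: measurable_normal_pdf.
- apply: ae_eqe_mul2l; apply: integral_ae_eq => //.
  + exact: Radon_Nikodym_SigmaFinite.f_integrable.
  + by apply/measurable_EFinP; exact: measurable_normal_pdf.
  + move=> E _ mE; rewrite -Radon_Nikodym_SigmaFinite.f_integral//.
Qed.

Let q (x : K) : K := - x ^+ 2 / (s ^+ 2 *+ 2).

Let is_derive_q (x : K) : is_derive x (1:K) q (- x / s ^+ 2).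
Proof. by apply: is_derive_eq; rewrite /GRing.scale/=; field. Qed.

Let pqE : p = fun x => normal_peak s * (expR \o q) x.
Proof. by apply/funext => x; exact: pE. Qed.

Let is_derive_p (x : K) : is_derive x (1:K) p (- x / s ^+ 2 * p x).
Proof.
rewrite pqE; have h := is_derive1_comp (is_derive_expR (q x)) (is_derive_q x).
by apply: is_derive_eq; rewrite /GRing.scale/=; ring.
Qed.

(* F is an antiderivative of f, to be used on [0, s] and, where f >= 0 as the
   fundamental theorem of calculus on a half-line requires, on [s, +oo[. *)
Let F (x : K) : K := - s ^+ 2 * x * p x.
Let f (x : K) : K := (x ^+ 2 - s ^+ 2) * p x.

Let is_derive_F (x : K) : is_derive x (1:K) F (f x).
Proof.
have h := is_derive_p x.
by apply: is_derive_eq; rewrite /f /GRing.scale/=; field.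
Qed.

Let F_cvg0 : F x @[x --> +oo] --> (0 : K).
Proof.
(* With y = x^2 / (2 s^2), exp y >= 1 + y >= y gives x exp(-y) <= 2 s^2 / x, hence |F x| <= c /
   x. *)
pose c := s ^+ 2 * normal_peak s * (s ^+ 2 *+ 2).
have cV : c * x^-1 @[x --> +oo] --> (0 : K).
  rewrite -[X in _ --> X](mulr0 c); apply: cvgMr => //.
  apply/gtr0_cvgV0; last exact: cvg_id.
  exact: nbhs_pinfty_gt.
apply/norm_cvg0P; apply: (squeeze_cvgr _ (cvg_cst 0) cV).
near=> x; have x0 : 0 < x by near: x; exact: nbhs_pinfty_gt.
rewrite normr_ge0 /F normrM normrM normrN (ger0_norm (sqr_ge0 s)).
rewrite (gtr0_norm x0) ger0_norm ?normal_pdf_ge0// pE -/(q x) /c.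
set y := x ^+ 2 / (s ^+ 2 *+ 2); have -> : q x = - y by rewrite /q mulNr.
have y0 : 0 < y by rewrite divr_gt0 ?exprn_gt0// mulrn_wgt0 ?exprn_gt0.
have ye : x * expR (- y) <= (s ^+ 2 *+ 2) / x.
  rewrite expRN ler_pdivlMr// mulrAC -expr2 ler_pdivrMr ?expR_gt0//.
  rewrite -ler_pdivrMl ?mulrn_wgt0 ?exprn_gt0// mulrC -/y.
  by rewrite (le_trans _ (expR_ge1Dx y))// lerDr.
have := ler_wpM2l (mulr_ge0 (sqr_ge0 s) (normal_peak_ge0 s)) ye.
by rewrite !mulrA (mulrAC _ _ x).
Unshelve. all: by end_near. Qed.

Let contf : continuous f.
Proof.
move=> x; apply: cvgM; last exact: continuous_normal_pdf.
apply: cvgB; last exact: cvg_cst.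
by rewrite expr2; apply: cvgM; exact: cvg_id.
Qed.

Let contF : continuous F.
Proof.
move=> x; apply: differentiable_continuous; apply/derivable1_diffP.
by have := is_derive_F x; case.
Qed.

Let int_f_tail : (\int[mu]_(x in `[s, +oo[) (f x)%:E = (- F s)%:E)%E.
Proof.
rewrite (ge0_continuous_FTC2y (l := 0) (F := F)) ?EFinN ?sub0e//.
- move=> x sx; rewrite mulr_ge0 ?normal_pdf_ge0// subr_ge0 ler_sqr// ?nnegrE ?ltW//.
  by rewrite (lt_le_trans s0).
- exact: continuous_subspaceT.
- by move=> x _; have := is_derive_F x; case.
- apply: cvg_at_right_filter; exact: contF.
- move=> x _; rewrite derive1E; exact: derive_val.
Qed.

Let int_f_head : (\int[mu]_(x in `[0%R, s]) (f x)%:E = (F s)%:E)%E.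
Proof.
rewrite (continuous_FTC2 (F := F) s0).
- by rewrite /F mulr0 mul0r sube0.
- exact: continuous_subspaceT.
- split; [move=> x _; by have := is_derive_F x; case
  |exact/cvg_at_right_filter/contF|exact/cvg_at_left_filter/contF].
- move=> x _; rewrite derive1E; exact: derive_val.
Qed.

Let mp : measurable_fun setT (EFin \o p).
Proof. by apply/measurable_EFinP; exact: measurable_normal_pdf. Qed.

Let sq_split (D : set K) : measurable D -> mu.-integrable D (EFin \o f) ->
  (\int[mu]_(x in D) (x ^+ 2 * p x)%:E =
   \int[mu]_(x in D) (f x)%:E + (s ^+ 2)%:E * \int[mu]_(x in D) (p x)%:E)%E.
Proof.
move=> mD fi; have ip : mu.-integrable D (EFin \o p).
  by apply: integrableS (integrable_normal_pdf 0 s).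
rewrite -integralZl// -integralD//; last exact: integrableZl.
by apply: eq_integral => x _; rewrite /= -EFinD /f; congr EFin; ring.
Qed.

(** Under the density, x^2 = (x^2 - s^2) + s^2. The first summand integrates to F s on [0, s] and to
    - F s beyond, so only s^2 survives. The cut is at s because [f] changes sign there. *)
Let second_half :
  (\int[mu]_(x in `[0%R, +oo[) (x ^+ 2 * p x)%:E =
   (s ^+ 2)%:E * \int[mu]_(x in `[0%R, +oo[) (p x)%:E)%E.
Proof.
have E : `[0, +oo[%classic = `[0, s]%classic `|` `]s, +oo[%classic :> set K.
  by rewrite -itv_bndbnd_setU// ?bnd_simp// ltW.
have dis : [disjoint `[0, s]%classic & `]s, +oo[%classic :> set K].
  apply/disj_setPS => x [] /=; rewrite !in_itv/= => /andP[_ xs] /andP[sx _].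
  by move: (lt_le_trans sx xs); rewrite ltxx.
have msq : measurable_fun setT (fun x : K => (x ^+ 2 * p x)%:E).
  apply/measurable_EFinP; apply: measurable_funM; last exact: measurable_normal_pdf.
  exact: measurable_funX.
have mf : measurable_fun setT (EFin \o f).
  by apply/measurable_EFinP; exact: continuous_measurable_fun.
have i1 : mu.-integrable `[0, s] (EFin \o f).
  apply: continuous_compact_integrable; first exact: segment_compact.
  exact: continuous_subspaceT.
have i2 : mu.-integrable `[s, +oo[ (EFin \o f).
  apply/integrableP; split; first exact: measurable_funTS.
  apply: (@le_lt_trans _ _ (\int[mu]_(x in `[s, +oo[) (f x)%:E)%E); last first.
    by rewrite int_f_tail ltry.
  rewrite le_eqVlt; apply/orP; left; apply/eqP; apply: eq_integral.
  move=> x; rewrite inE/= in_itv/= andbT => sx; rewrite ger0_norm//.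
  rewrite mulr_ge0 ?normal_pdf_ge0// subr_ge0 ler_sqr// ?nnegrE ?ltW//.
  by rewrite (lt_le_trans s0).
rewrite E !ge0_integral_setU//.
- rewrite !integral_itv_obnd_cbnd; try exact: measurable_funTS.
  rewrite (sq_split _ i1)// (sq_split _ i2)//.
  rewrite int_f_head int_f_tail addeACA -EFinD subrr add0e.
  have g D : (0 <= \int[mu]_(x in D) (p x)%:E)%E.
    by apply: integral_ge0 => x _; rewrite lee_fin normal_pdf_ge0.
  by rewrite (ge0_muleDr _ (g _) (g _)).
- exact: measurable_funTS.
- by move=> x _; rewrite lee_fin normal_pdf_ge0.
- exact: measurable_funTS.
- by move=> x _; rewrite lee_fin mulr_ge0 ?sqr_ge0 ?normal_pdf_ge0.
Qed.

Lemma normal_second_moment :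
  (\int[normal_prob 0%R s]_x (x ^+ 2)%:E = (s ^+ 2)%:E)%E.
Proof.
rewrite ge0_integral_normal; last 2 first.
- by move=> x; rewrite lee_fin sqr_ge0.
- by apply/measurable_EFinP; exact: measurable_funX.
transitivity (\int[mu]_x (x ^+ 2 * p x)%:E)%E; first exact: eq_integral.
have cp : continuous p by exact: continuous_normal_pdf.
rewrite ge0_symfun_integralT.
- rewrite -set_itvcy second_half muleCA set_itvcy -ge0_symfun_integralT//.
  + by rewrite integral_normal_pdf mule1.
  + by move=> x; exact: normal_pdf_ge0.
  + by move=> x; rewrite /= normal_pdf_opp.
- by move=> x; rewrite mulr_ge0 ?sqr_ge0 ?normal_pdf_ge0.
- move=> x; apply: cvgM; last exact: cp.
  by rewrite expr2; apply: cvgM; exact: cvg_id.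
- by move=> x; rewrite /= normal_pdf_opp sqrrN.
Qed.

Lemma sqint_normal : sqint (normal_prob 0 s) id.
Proof.
split; first exact: measurable_id.
apply/integrableP; split; first by apply/measurable_EFinP; exact: measurable_funX.
apply: (@le_lt_trans _ _ (\int[normal_prob 0%R s]_x (x ^+ 2)%:E)%E); last first.
  by rewrite normal_second_moment ltry.
rewrite le_eqVlt; apply/orP; left; apply/eqP; apply: eq_integral.
by move=> x _; rewrite /= ger0_norm ?sqr_ge0.
Qed.

Let normal_prob_opp (A : set K) : measurable A ->
  normal_prob 0 s A = normal_prob 0 s (-%R @^-1` A).
Proof.
move=> mA; rewrite /normal_prob.
transitivity (\int[pushforward mu (-%R : K -> measurableTypeR K)]_(x in A)
    (p x)%:E)%E.
  by apply: eq_measure_integral => B mB _; exact/esym/lebesgue_measureN.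
rewrite ge0_integral_pushforward//.
- by apply: eq_integral => x _; rewrite /= normal_pdf_opp.
- exact: measurable_funTS.
- by move=> x _; rewrite lee_fin normal_pdf_ge0.
Qed.

Lemma int1_normal_id : int1 (normal_prob 0 s) id.
Proof.
have h : int1 (normal_prob 0 s) (fun x : K => 1 + x ^+ 2).
  apply: int1D; last exact: sqint_normal.2.
  exact: finite_measure_integrable_cst.
apply: int1_le h; first exact: measurable_id.
move=> x; rewrite [leRHS]ger0_norm ?addr_ge0 ?sqr_ge0//.
rewrite -(real_normK (num_real x)).
by have := sqr_ge0 (`|x| - 1); have := normr_ge0 x; nra.
Qed.

(** The law is invariant under reflection, so its mean equals its own negative. *)
Lemma normal_mean : \int[normal_prob 0 s]_x x = 0.
Proof.
have iN : int1 (normal_prob 0 s) (fun x : K => - x) by exact: int1N int1_normal_id.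
have [] := @Rint_pushforward _ _ (measurableTypeR K) (measurableTypeR K) K
  (normal_prob 0 s) (normal_prob 0 s) -%R id _ _ normal_prob_opp iN.
- by apply: oppr_measurable.
- exact: measurable_id.
have half (r : K) : -1 * r = r -> r = 0 by lra.
move=> _ h; have e : \int[normal_prob 0 s]_x (- x) = -1 * \int[normal_prob 0 s]_x x.
  rewrite -[RHS](RintZ (-1) int1_normal_id).
  by apply: eq_Rint => x; rewrite mulN1r.
exact: half (etrans (esym e) h).
Qed.

End NormalMoments.

(** * Brownian increments and their moments *)

Section Increments.
Context {K : realType} {d : measure_display} {Omega : measurableType d}.
Variables (Pr : probability Omega K) (w : K -> Omega -> K).
Hypothesis hw : brownian_motion Pr w.
Implicit Types (X Y z : Omega -> K) (a b c s t : K).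

Local Notation Ft := (natural_filtration w 0).
Local Notation D := (increment w).

(** Reads measurability for a generated sigma-algebra as ordinary measurability on the space that
    carries it, whence the closure properties that follow. *)
Lemma measurable_wrtP (G : set (set Omega)) X :
  measurable_wrt <<s G >> X <->
  measurable_fun setT (X : g_sigma_algebraType G -> K).
Proof.
split=> [h _ B mB|h B mB]; first by rewrite setTI; exact: h.
by rewrite -[X @^-1` B]setTI; exact: h.
Qed.

Lemma wrtM t0 t X Y : measurable_wrt (natural_filtration w t0 t) X ->
  measurable_wrt (natural_filtration w t0 t) Y ->
  measurable_wrt (natural_filtration w t0 t) (fun om => X om * Y om).
Proof.
move=> /measurable_wrtP hX /measurable_wrtP hY; apply/measurable_wrtP.
exact: measurable_funM.
Qed.

Lemma wrtD t0 t X Y : measurable_wrt (natural_filtration w t0 t) X ->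
  measurable_wrt (natural_filtration w t0 t) Y ->
  measurable_wrt (natural_filtration w t0 t) (fun om => X om + Y om).
Proof.
move=> /measurable_wrtP hX /measurable_wrtP hY; apply/measurable_wrtP.
exact: measurable_funD.
Qed.

Lemma wrt_cst t0 t c : measurable_wrt (natural_filtration w t0 t) (fun=> c).
Proof. by apply/measurable_wrtP; exact: measurable_cst. Qed.

Lemma wrt_sum t0 t (I : Type) (r : seq I) (X : I -> Omega -> K) :
  (forall i, measurable_wrt (natural_filtration w t0 t) (X i)) ->
  measurable_wrt (natural_filtration w t0 t) (fun om => \sum_(i <- r) X i om).
Proof.
move=> hX; apply/measurable_wrtP; apply: measurable_sum => i.
exact/measurable_wrtP.
Qed.

Lemma wrtB t0 t X Y : measurable_wrt (natural_filtration w t0 t) X ->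
  measurable_wrt (natural_filtration w t0 t) Y ->
  measurable_wrt (natural_filtration w t0 t) (fun om => X om - Y om).
Proof.
move=> /measurable_wrtP hX /measurable_wrtP hY; apply/measurable_wrtP.
exact: measurable_funB.
Qed.

Lemma natural_filtration_le s t s' t' : s <= s' -> t' <= t ->
  natural_filtration w s' t' `<=` natural_filtration w s t.
Proof.
move=> ss tt; apply: sub_sigma_algebra2 => E [r /andP[sr rt] [B mB ->]].
by exists r; [rewrite (le_trans ss)// (le_trans rt)|exists B].
Qed.

Lemma wrt_le s t s' t' X : s <= s' -> t' <= t ->
  measurable_wrt (natural_filtration w s' t') X ->
  measurable_wrt (natural_filtration w s t) X.
Proof. by move=> ss tt h B mB; apply: natural_filtration_le (h B mB). Qed.

Lemma natural_filtration_measurable s t : 0 <= s ->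
  natural_filtration w s t `<=` measurable.
Proof.
move=> s0; apply: smallest_sub; first exact: sigma_algebra_measurable.
move=> E [r /andP[sr _] [B mB ->]]; rewrite -[_ @^-1` _]setTI.
by apply: (bm_measurable hw) => //; exact: le_trans sr.
Qed.

Lemma wrt_measurable s t X : 0 <= s ->
  measurable_wrt (natural_filtration w s t) X -> measurable_fun setT X.
Proof.
move=> s0 hX _ B mB; rewrite setTI.
by apply: natural_filtration_measurable s0 _ _; exact: hX.
Qed.

Lemma wrt_increment s t a : 0 <= s <= a -> 0 <= t <= a ->
  measurable_wrt (Ft a) (D s t).
Proof.
move=> sa ta; have h r : 0 <= r <= a -> measurable_wrt (Ft a) (w r).
  move=> ra B mB; apply: sub_sigma_algebra; exists r => //.
  by exists B.
by apply: wrtB; exact: h.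
Qed.

Lemma increment_same s om : D s s om = 0.
Proof. by rewrite /increment subrr. Qed.

Lemma increment_moments s t : 0 <= s <= t ->
  [/\ sqint Pr (D s t), \int[Pr]_om D s t om = 0 &
      \int[Pr]_om D s t om ^+ 2 = t - s].
Proof.
move=> /andP[s0]; rewrite le_eqVlt => /predU1P[<-|st].
  (* The Gaussian law is given for s < t only, but clipping intervals at a time t produces
     degenerate ones too. *)
  rewrite (_ : D s s = fun=> 0); last by apply/funext => om; exact: increment_same.
  split; [exact: sqint0|exact: Rint0|].
  by rewrite subrr -[RHS](Rint0 Pr); apply: eq_Rint => om; rewrite expr0n.
set sg := Num.sqrt (t - s).
have sg0 : 0 < sg by rewrite sqrtr_gt0 subr_gt0.
have mD : measurable_fun setT (D s t).
  apply: (wrt_measurable (s := 0) (t := t)) => //; apply: wrt_increment.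
    by rewrite s0 ltW.
  by rewrite lexx andbT (le_trans s0)// ltW.
have mE A : measurable A -> normal_prob 0 sg A = Pr (D s t @^-1` A).
  by move=> mA; rewrite (bm_gaussian hw).
have msq : measurable_fun setT (fun x : K => x ^+ 2) by exact: measurable_funX.
have i1 : int1 Pr (D s t).
  exact: (@int1_pushforward _ _ Omega (measurableTypeR K) K Pr (normal_prob 0 sg)
    (D s t) id mD (@measurable_id _ _ _) mE (int1_normal_id sg0)).
have i2 : int1 Pr (fun om => D s t om ^+ 2).
  exact: (@int1_pushforward _ _ Omega (measurableTypeR K) K Pr (normal_prob 0 sg)
    (D s t) _ mD msq mE (sqint_normal sg0).2).
split; first by split.
- have [_ /= ->] := @Rint_pushforward _ _ Omega (measurableTypeR K) K Pr
    (normal_prob 0 sg) (D s t) id mD (@measurable_id _ _ _) mE i1.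
  exact: normal_mean.
- have [_ /= ->] := @Rint_pushforward _ _ Omega (measurableTypeR K) K Pr
    (normal_prob 0 sg) (D s t) _ mD msq mE i2.
  by rewrite /Rintegral normal_second_moment//= sqr_sqrtr// subr_ge0 ltW.
Qed.

Lemma sqint_int1 X : sqint Pr X -> int1 Pr X.
Proof.
move=> sX; rewrite (_ : X = fun om => 1 * X om).
  apply: sqint_mul sX; split => //.
  by rewrite expr1n; exact: finite_measure_integrable_cst.
by apply/funext => om; rewrite mul1r.
Qed.

Lemma increment_indep s t z : 0 <= s < t -> measurable_wrt (Ft s) z ->
  indep Pr z (D s t).
Proof.
by move=> /andP[s0 st] hz A B mA mB; rewrite (bm_independent hw)//; exact: hz.
Qed.

(** [z] is allowed to be merely square-integrable, since it will contain the value of a drift. In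
    [increment_variance] it is bounded, as products of values of simple processes are, which keeps z
    times the squared increment integrable. *)
Lemma increment_martingale s t z : 0 <= s <= t -> measurable_wrt (Ft s) z ->
  sqint Pr z -> \int[Pr]_om (z om * D s t om) = 0.
Proof.
move=> st hz sz; have [sD D0 _] := increment_moments st.
move: st => /andP[s0]; rewrite le_eqVlt => /predU1P[<-|st].
  by rewrite -[RHS](Rint0 Pr); apply: eq_Rint => om; rewrite increment_same mulr0.
rewrite indep_Rint_mul ?D0 ?mulr0//; [exact: sz.1|exact: sD.1|..].
- by apply: increment_indep hz; rewrite s0.
- exact: sqint_int1.
- exact: sqint_int1.
- exact: sqint_mul.
Qed.

Lemma sqint_bounded c X : measurable_fun setT X -> (forall om, `|X om| <= c) ->
  sqint Pr X.
Proof.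
move=> mX Xc; apply: (sqint_le (g := fun=> c)) => //.
  by move=> om; rewrite (le_trans (Xc om)) ?ler_norm.
by split => //; exact: finite_measure_integrable_cst.
Qed.

Lemma increment_variance s t z c : 0 <= s <= t -> measurable_wrt (Ft s) z ->
  (forall om, `|z om| <= c) ->
  \int[Pr]_om (z om * D s t om ^+ 2) = (\int[Pr]_om z om) * (t - s).
Proof.
move=> st hz zc; have [sD _ D2] := increment_moments st.
move: st => /andP[s0]; rewrite le_eqVlt => /predU1P[<-|st].
  rewrite subrr mulr0 -[RHS](Rint0 Pr); apply: eq_Rint => om.
  by rewrite increment_same expr0n mulr0.
have mz : measurable_fun setT z by apply: (wrt_measurable (s := 0)) hz.
have sz := sqint_bounded mz zc.
have szD := sqint_bounded_mul mz zc sD.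
rewrite indep_Rint_mul ?D2//.
- exact: measurable_funX sD.1.
- move=> A B mA mB.
  have mB' : measurable ((fun x : K => x ^+ 2) @^-1` B).
    have msq : measurable_fun setT (fun x : K => x ^+ 2) by exact: measurable_funX.
    by rewrite -[_ @^-1` _]setTI; exact: msq.
  by apply: (increment_indep _ hz mA mB'); rewrite s0.
- exact: sqint_int1.
- exact: sD.2.
- by apply: eq_int1 (sqint_mul szD sD) => om; rewrite expr2 mulrA.
Qed.

End Increments.

(** * Simple processes *)

Section SimpleTerms.
Context {K : realType} {d : measure_display} {Omega : measurableType d}.
Variables (Pr : probability Omega K) (w : K -> Omega -> K).
Hypothesis hw : brownian_motion Pr w.
Implicit Types (x y z : Omega -> K) (a b c e s t : K).

Local Notation Ft := (natural_filtration w 0).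
Local Notation D := (increment w).

Definition bounded_wrt t x : Prop :=
  measurable_wrt (Ft t) x /\ exists c, forall om, `|x om| <= c.

Lemma bounded_wrtM t x y : bounded_wrt t x -> bounded_wrt t y ->
  bounded_wrt t (fun om => x om * y om).
Proof.
move=> [hx [c xc]] [hy [e ye]]; split; first exact: wrtM.
by exists (c * e) => om; rewrite normrM ler_pM.
Qed.

Lemma bounded_wrt_le s t x : s <= t -> bounded_wrt s x -> bounded_wrt t x.
Proof. by move=> st [hx bx]; split => //; exact: wrt_le hx. Qed.

Lemma bounded_wrt_sqint t x : bounded_wrt t x -> sqint Pr x.
Proof.
by move=> [hx [c xc]]; apply: sqint_bounded xc; exact: (wrt_measurable hw) hx.
Qed.

Lemma bounded_wrt_mul_sqint t x z : bounded_wrt t x -> sqint Pr z ->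
  sqint Pr (fun om => x om * z om).
Proof.
move=> [hx [c xc]] sz; apply: sqint_bounded_mul xc sz.
exact: (wrt_measurable hw) hx.
Qed.

Lemma sqint_increment s t : 0 <= s <= t -> sqint Pr (D s t).
Proof. by move=> /(increment_moments hw)[]. Qed.

Lemma increment_cross x a b c e : 0 <= a <= b -> b <= c <= e ->
  bounded_wrt c x ->
  \int[Pr]_om (x om * D a b om * D c e om) = 0.
Proof.
move=> /andP[a0 ab] /andP[bc ce] hx.
apply: (increment_martingale hw).
- by rewrite ce (le_trans a0)// (le_trans ab).
- apply: wrtM; first exact: hx.1.
  by apply: wrt_increment; rewrite ?a0 ?(le_trans ab)// (le_trans a0).
- by apply: bounded_wrt_mul_sqint hx _; apply: sqint_increment; rewrite a0.
Qed.

(** With f = min(b, e), both increments are cut at c and f. Products of pieces over disjoint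
    intervals have mean 0, so only the square over the overlap ]c, f] contributes, and independence
    gives it the length of the overlap as a factor. *)
Lemma term_pair_core x y a b c e : 0 <= a -> a <= b -> c <= e -> a <= c ->
  bounded_wrt a x -> bounded_wrt c y ->
  \int[Pr]_om ((x om * D a b om) * (y om * D c e om)) =
  (\int[Pr]_om (x om * y om)) * Num.max 0 (Num.min b e - c).
Proof.
move=> a0 ab ce ac hx hy.
have c0 : 0 <= c by exact: le_trans ac.
have hxy : bounded_wrt c (fun om => x om * y om).
  by apply: bounded_wrtM hy; exact: bounded_wrt_le hx.
have [bc|cb] := leP b c.
  rewrite max_l ?mulr0; last first.
    by rewrite subr_le0 ge_min bc.
  rewrite -[RHS](@increment_cross _ a b c e _ _ hxy) ?a0 ?bc//.
  by apply: eq_Rint => om; ring.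
set f := Num.min b e.
have cf : c <= f by rewrite le_min (ltW cb) ce.
have fb : f <= b by rewrite ge_min lexx.
have fe : f <= e by rewrite ge_min lexx orbT.
rewrite max_r ?subr_ge0//.
have f0 : 0 <= f by exact: le_trans cf.
(* f is one of b and e, so one of the two pieces beyond f is degenerate. *)
have z om : D f b om * D f e om = 0.
  rewrite /f; case: (leP b e) => _; first by rewrite increment_same mul0r.
  by rewrite increment_same mulr0.
rewrite (eq_Rint _ (g := fun om =>
  ((x om * y om * D a c om) * D c e om + (x om * y om) * D c f om ^+ 2) +
  ((x om * y om * D c f om) * D f e om + (x om * y om * D c f om) * D f b om))); last first.
  move=> om.
  have -> : D a b om = D a c om + D c f om + D f b om by rewrite /increment; ring.
  have e1 : D c e om = D c f om + D f e om by rewrite /increment; ring.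
  rewrite (_ : _ * D a c om * D c e om = x om * y om * D a c om * (D c f om + D f e om)) ?e1//.
  transitivity ((x om * (D a c om + D c f om + D f b om)) *
    (y om * (D c f om + D f e om)) - x om * y om * (D f b om * D f e om)).
    by rewrite z mulr0 subr0.
  ring.
have sac : sqint Pr (D a c) by apply: sqint_increment; rewrite a0.
have sce : sqint Pr (D c e) by apply: sqint_increment; rewrite c0.
have scf : sqint Pr (D c f) by apply: sqint_increment; rewrite c0.
have sfe : sqint Pr (D f e) by apply: sqint_increment; rewrite f0.
have sfb : sqint Pr (D f b) by apply: sqint_increment; rewrite f0.
have i1 := sqint_mul (bounded_wrt_mul_sqint hxy sac) sce.
have i2 : int1 Pr (fun om => x om * y om * D c f om ^+ 2).
  by apply: eq_int1 (sqint_mul (bounded_wrt_mul_sqint hxy scf) scf) => om; ring.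
have i3 := sqint_mul (bounded_wrt_mul_sqint hxy scf) sfe.
have i4 := sqint_mul (bounded_wrt_mul_sqint hxy scf) sfb.
have hxyf := bounded_wrt_le cf hxy.
rewrite RintD; [|exact: int1D|exact: int1D].
rewrite RintD// RintD//.
rewrite (@increment_cross _ a c c e) ?a0 ?ac ?lexx//.
rewrite (@increment_cross _ c f f e) ?c0 ?cf ?lexx//.
rewrite (@increment_cross _ c f f b) ?c0 ?cf ?lexx//.
case: hxy => hxy [k xyk].
rewrite (increment_variance hw _ hxy xyk) ?c0//.
by rewrite add0r !addr0.
Qed.

Lemma term_pair x y a b c e t : 0 <= a -> 0 <= c -> a <= b -> c <= e ->
  bounded_wrt a x -> bounded_wrt c y ->
  \int[Pr]_om ((x om * D (Num.min t a) (Num.min t b) om) *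
               (y om * D (Num.min t c) (Num.min t e) om)) =
  (\int[Pr]_om (x om * y om)) *
  Num.max 0 (Num.min (Num.min t b) (Num.min t e) - Num.max a c).
Proof.
wlog ac : x y a b c e / a <= c.
  move=> H a0 c0 ab ce hx hy; have [ac|] := boolP (a <= c).
    exact: H.
  rewrite -ltNge => ac.
  rewrite (eq_Rint _ (g := fun om => (y om * D (Num.min t c) (Num.min t e) om) *
    (x om * D (Num.min t a) (Num.min t b) om))); last by move=> om; rewrite mulrC.
  rewrite H ?(ltW ac)// (minC (Num.min t e)) (maxC c).
  by congr (_ * _); apply: eq_Rint => om; rewrite mulrC.
move=> a0 c0 ab ce hx hy.
(* If t <= c, the second clipped increment is degenerate. Otherwise a <= c < t, so clipping leaves
   both left ends in place, and x and y are still known there. *)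
have [tc|ct] := leP t c.
  have te : t <= e by exact: le_trans ce.
  rewrite max_l ?mulr0; last first.
    rewrite subr_le0 !ge_min !le_max; apply/orP; left; apply/orP; left.
    by rewrite tc orbT.
  rewrite -[RHS](Rint0 Pr); apply: eq_Rint => om.
  by rewrite !(min_l te) increment_same !mulr0.
rewrite (min_r (le_trans ac (ltW ct))) (max_r ac).
by apply: term_pair_core => //; rewrite le_min ?ab ?ce ?(ltW ct) ?(le_trans ac (ltW ct)).
Qed.

End SimpleTerms.

(** * Processes as functions on time x Omega *)

Section ProductSpace.
Context {K : realType} {d : measure_display} {Omega : measurableType d}.
Variable Pr : probability Omega K.
Local Notation mu := (@lebesgue_measure K).
Local Notation nu := (mu \x Pr)%E.

Lemma measurable_time_indic (a b : K) :
  measurable_fun setT (fun s : measurableTypeR K => (a <= s <= b)%R%:R : K).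
Proof.
rewrite (_ : (fun s => _) = \1_`[a, b]); first exact: measurable_indic.
by apply/funext => s; rewrite indicE mem_setE in_itv.
Qed.

Lemma Rint_itv_oc (p q : K) :
  int1 mu (fun s : K => (p < s <= q)%R%:R) /\
  \int[mu]_s ((p < s <= q)%R%:R : K) = Num.max 0 (q - p).
Proof.
have E : (fun s : K => (p < s <= q)%R%:R : K) = \1_`]p, q].
  by apply/funext => s; rewrite indicE mem_setE in_itv.
rewrite E; split; first exact: integrable_indic_itv.
rewrite /Rintegral integral_indic// setIT.
have := lebesgue_measure_itv `]p, q]; rewrite /= lte_fin => e.
transitivity (fine (if p < q then (q%:E - p%:E)%E else 0%E)).
  by congr fine; exact: e.
case: ltP => pq /=; first by rewrite max_r// subr_ge0 ltW.
by rewrite max_l// subr_le0.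
Qed.

(* Extending a process by 0 outside of [t0, t] makes the Fubini theorems, which
   are stated for functions on the whole product space, applicable. *)
Definition cut (t0 t : K) (f : K -> Omega -> K) (z : measurableTypeR K * Omega) : K :=
  f z.1 z.2 * (t0 <= z.1 <= t)%R%:R.

End ProductSpace.

(** * Isometry and martingale property of simple integrals *)

Section SimpleProcesses.
Context {K : realType} {d : measure_display} {Omega : measurableType d}.
Variables (Pr : probability Omega K) (w : K -> Omega -> K) (t0 T : K).
Hypotheses (hw : brownian_motion Pr w) (ht0 : 0 <= t0).
Local Notation mu := (@lebesgue_measure K).
Local Notation nu := (mu \x Pr)%E.
Local Notation simple := (simple_process w t0 T).
Implicit Types (g h : @step_process K d Omega) (t s : K).

Lemma simple_term g i : simple g -> (i < sp_size g)%N ->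
  [/\ t0 <= sp_left g i, sp_left g i <= sp_right g i &
      bounded_wrt w (sp_left g i) (sp_val g i)].
Proof.
move=> sg /sg [t0l lr _ hv hb]; split => //; split => //.
exact: wrt_le hv.
Qed.

Lemma sqint_sp_term g t i : simple g -> t0 <= t -> (i < sp_size g)%N ->
  sqint Pr (fun om => sp_val g i om *
    increment w (Num.min t (sp_left g i)) (Num.min t (sp_right g i)) om).
Proof.
move=> sg t0t ig; have [t0l lr hv] := simple_term sg ig.
apply: (bounded_wrt_mul_sqint hw hv); apply: (sqint_increment hw).
by rewrite le_min (le_trans ht0 t0t) (le_trans ht0 t0l) le_min2.
Qed.

Lemma sqint_sp_integral g t : simple g -> t0 <= t ->
  sqint Pr (sp_integral w g t).
Proof. by move=> sg t0t; apply: sqint_sum => i; exact: sqint_sp_term. Qed.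

(** The interval on the right is the overlap whose length appears in [term_pair]; this makes the
    isometry a termwise comparison. *)
Lemma cut_term_mul (x y : Omega -> K) (a b c e t : K) (z : measurableTypeR K * Omega) :
  t0 <= a ->
  cut t0 t (fun s om => x om * (a < s <= b)%R%:R) z *
  cut t0 t (fun s om => y om * (c < s <= e)%R%:R) z =
  (Num.max a c < z.1 <= Num.min (Num.min t b) (Num.min t e))%R%:R * (x z.2 * y z.2).
Proof.
move=> t0a; rewrite /cut gt_max !le_min.
case: (ltP a z.1) => az /=; last by rewrite !(mulr0, mul0r).
rewrite (ltW (le_lt_trans t0a az)) /=.
case: (c < z.1); case: (z.1 <= b); case: (z.1 <= e); case: (z.1 <= t);
  rewrite /= ?(mulr0, mul0r, mulr1, mul1r)//.
Qed.

Lemma cut_sp_eval g t z : cut t0 t (sp_eval g) z =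
  \sum_(i < sp_size g) cut t0 t (fun s om =>
     sp_val g i om * (sp_left g i < s <= sp_right g i)%R%:R) z.
Proof. by rewrite /cut /sp_eval mulr_suml. Qed.

Lemma sqint_cut_sp_term g t i : simple g -> (i < sp_size g)%N ->
  sqint nu (cut t0 t (fun s om =>
     sp_val g i om * (sp_left g i < s <= sp_right g i)%R%:R)).
Proof.
move=> sg ig; have [t0l lr hv] := simple_term sg ig.
have sv := bounded_wrt_sqint hw hv.
have mI (a b : K) :
    measurable_fun setT (fun s : measurableTypeR K => (a < s <= b)%R%:R : K).
  exact: int1_meas (Rint_itv_oc a b).1.
split.
  apply: measurable_funM; last first.
    exact: (measurableT_comp (measurable_time_indic t0 t)).
  apply: measurable_funM; last exact: (measurableT_comp (mI _ _)).
  by apply: measurableT_comp => //; exact: sv.1.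
have [h _] := Rint_tensor (Rint_itv_oc (Num.max (sp_left g i) (sp_left g i))
  (Num.min (Num.min t (sp_right g i)) (Num.min t (sp_right g i)))).1
  (sqint_mul sv sv).
apply: eq_int1 h => z; rewrite expr2 cut_term_mul//.
Qed.

Lemma sqint_cut_sp_eval g t : simple g -> sqint nu (cut t0 t (sp_eval g)).
Proof.
move=> sg; rewrite (_ : cut _ _ _ = fun z => \sum_(i < sp_size g) cut t0 t (fun s om =>
     sp_val g i om * (sp_left g i < s <= sp_right g i)%R%:R) z); last first.
  by apply/funext => z; exact: cut_sp_eval.
by apply: sqint_sum => i; exact: sqint_cut_sp_term.
Qed.

(** Two processes with unrelated intervals are compared: both sides expand into double sums over
    pairs of terms, matched pair by pair, so no common partition is formed. *)
Lemma sp_isometry g h t : simple g -> simple h -> t0 <= t ->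
  \int[Pr]_om (sp_integral w g t om * sp_integral w h t om) =
  \int[nu]_z (cut t0 t (sp_eval g) z * cut t0 t (sp_eval h) z).
Proof.
move=> sg sh t0t.
have hI (i : 'I_(sp_size g)) (j : 'I_(sp_size h)) :=
  sqint_mul (sqint_sp_term sg t0t (ltn_ord i)) (sqint_sp_term sh t0t (ltn_ord j)).
have hC (i : 'I_(sp_size g)) (j : 'I_(sp_size h)) :=
  sqint_mul (sqint_cut_sp_term t sg (ltn_ord i)) (sqint_cut_sp_term t sh (ltn_ord j)).
rewrite (eq_Rint _ (fun om => big_distrlr _ _ _ _ _ _ _)).
rewrite Rint_sum; last by move=> i; apply: int1_sum => j; exact: hI.
rewrite [RHS](eq_Rint _ (g := fun z => \sum_(i < sp_size g) \sum_(j < sp_size h)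
  (cut t0 t (fun s om => sp_val g i om * (sp_left g i < s <= sp_right g i)%R%:R) z *
   cut t0 t (fun s om => sp_val h j om * (sp_left h j < s <= sp_right h j)%R%:R) z)));
   last by move=> z; rewrite !cut_sp_eval big_distrlr.
rewrite [RHS]Rint_sum; last by move=> i; apply: int1_sum => j; exact: hC.
apply: eq_bigr => i _; rewrite Rint_sum; last by move=> j; exact: hI.
rewrite [RHS]Rint_sum; last by move=> j; exact: hC.
apply: eq_bigr => j _.
have [t0l lr hv] := simple_term sg (ltn_ord i).
have [t0l' lr' hv'] := simple_term sh (ltn_ord j).
rewrite (term_pair hw)//; [|exact: le_trans t0l|exact: le_trans t0l'].
rewrite (eq_Rint _ (fun z => @cut_term_mul _ _ _ _ _ _ t z t0l)).
have [i1 E1] := Rint_itv_oc (Num.max (sp_left g i) (sp_left h j))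
  (Num.min (Num.min t (sp_right g i)) (Num.min t (sp_right h j))).
have [_ E2] := Rint_tensor i1 (sqint_mul (bounded_wrt_sqint hw hv) (bounded_wrt_sqint hw hv')).
by rewrite mulrC -E1; exact: esym E2.
Qed.

Lemma sp_martingale g s t z : simple g -> t0 <= s <= t ->
  measurable_wrt (natural_filtration w 0 s) z -> sqint Pr z ->
  \int[Pr]_om (z om * sp_integral w g t om) =
  \int[Pr]_om (z om * sp_integral w g s om).
Proof.
move=> sg /andP[t0s st] hz sz.
have s0 : 0 <= s by exact: le_trans t0s.
have hI r (i : 'I_(sp_size g)) (rt : t0 <= r) :=
  sqint_mul sz (sqint_sp_term sg rt (ltn_ord i)).
rewrite (eq_Rint _ (fun om => mulr_sumr _ _ _ _)).
rewrite [RHS](eq_Rint _ (fun om => mulr_sumr _ _ _ _)).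
rewrite Rint_sum; last by move=> i; apply: hI; exact: le_trans st.
rewrite Rint_sum; last by move=> i; exact: hI.
apply: eq_bigr => i _; apply/eqP; rewrite -subr_eq0; apply/eqP.
rewrite -RintB; [|by apply: hI; exact: le_trans st|exact: hI].
have [t0a ab hv] := simple_term sg (ltn_ord i).
set a := sp_left g i in t0a ab hv *; set b := sp_right g i in ab *.
set x := sp_val g i in hv *.
have a0 : 0 <= a by exact: le_trans t0a.
(* ]p, q] is the part of ]a, b] between s and t; the two clipped increments differ by the increment
   over it, which starts no earlier than s. *)
pose p := Num.min t (Num.max s a); pose q := Num.min t (Num.max s b).
rewrite (eq_Rint _ (g := fun om => z om * x om * increment w p q om)); last first.
  move=> om; rewrite -mulrBr -mulrA -mulrBr; congr (_ * (_ * _)).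
  rewrite /increment /p /q.
  case: (leP s a) => sa; case: (leP s b) => sb.
  - ring.
  - by move: (le_trans sa ab); rewrite leNgt sb.
  - rewrite (min_r st) (min_r (ltW (lt_le_trans sa st))); ring.
  - rewrite (min_r st) (min_r (ltW (lt_le_trans sa st))).
    rewrite (min_r (ltW (lt_le_trans sb st))); ring.
(* If t <= a, then p = q = t may precede a, when x is not yet known, but the increment vanishes. *)
have [ta|at_] := leP t a.
  rewrite -[RHS](Rint0 Pr); apply: eq_Rint => om.
  rewrite (_ : p = t) 1?(_ : q = t) ?increment_same ?mulr0//.
  - by rewrite /q min_l// le_max (le_trans ta ab) orbT.
  - by rewrite /p min_l// le_max ta orbT.
have pE : p = Num.max s a by rewrite /p min_r// ge_max st ltW.
have pq : 0 <= p <= q.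
  by rewrite pE le_max s0 /= /q le_min !ge_max st (ltW at_) !le_max lexx ab orbT.
have zxp : measurable_wrt (natural_filtration w 0 p) (fun om => z om * x om).
  apply: wrtM; first by apply: wrt_le hz => //; rewrite pE le_max lexx.
  by apply: wrt_le hv.1 => //; rewrite pE le_max lexx orbT.
apply: (increment_martingale hw pq zxp).
rewrite (_ : (fun om => _) = (fun om => x om * z om)).
  exact: bounded_wrt_mul_sqint hv sz.
by apply/funext => om; rewrite mulrC.
Qed.

End SimpleProcesses.

Section SquareIntegrableLimits.
Context d (D : measurableType d) (K : realType).
Variable mu : {measure set D -> \bar K}.

Lemma Rint_sqB_cvg0 (u v : nat -> D -> K) :
  (forall k, sqint mu (u k)) -> (forall k, sqint mu (v k)) ->
  (fun k => \int[mu]_x u k x ^+ 2) @ \oo --> (0 : K) ->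
  (fun k => \int[mu]_x v k x ^+ 2) @ \oo --> (0 : K) ->
  (fun k => \int[mu]_x (u k x - v k x) ^+ 2) @ \oo --> (0 : K).
Proof.
move=> su sv u0 v0.
have h : (fun k => 2 * (\int[mu]_x u k x ^+ 2) + 2 * \int[mu]_x v k x ^+ 2)
    @ \oo --> (0 : K).
  rewrite -[X in _ --> X](_ : 2 * 0 + 2 * 0 = 0 :> K); last by rewrite mulr0 addr0.
  by apply: cvgD; apply: cvgMr.
apply: (squeeze_cvgr _ (cvg_cst 0) h); apply: nearW => k.
rewrite Rint_sq_ge0 /= -!RintZ; [|exact: (sv k).2|exact: (su k).2].
rewrite -RintD; [|exact: int1Z (su k).2|exact: int1Z (sv k).2].
apply: le_Rintegral => //.
- exact: (sqintB (su k) (sv k)).2.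
- exact: int1D (int1Z 2 (su k).2) (int1Z 2 (sv k).2).
- by move=> x _; have := sqr_ge0 (u k x + v k x); nra.
Qed.

End SquareIntegrableLimits.

(** * Restriction of processes to a time interval *)

Section Cut.
Context {K : realType} {d : measure_display} {Omega : measurableType d}.
Variable Pr : probability Omega K.
Local Notation mu := (@lebesgue_measure K).
Local Notation nu := (mu \x Pr)%E.
Implicit Types (f h : K -> Omega -> K) (s t : K).

Lemma measurable_cut t0 T t f : t <= T ->
  measurable_fun (`[t0, T] `*` setT) (fun a : K * Omega => f a.1 a.2) ->
  measurable_fun setT (cut t0 t f).
Proof.
move=> tT mf.
pose D : set (measurableTypeR K * Omega) := `[t0, t]%classic `*` setT.
have mD : measurable D.
  exact: measurableX.
have mf' : measurable_fun D (fun a => f a.1 a.2).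
  apply: measurable_funS mf; first exact: measurableX.
  move=> [s om] [/= /andP[t0s st] _]; split => //=.
  by rewrite in_itv/=; apply/andP; split => //; exact: le_trans tT.
rewrite (_ : cut t0 t f = (fun a => f a.1 a.2) \_ D).
  exact/(measurable_restrictT _ mD).
apply/funext => -[s om]; rewrite /cut patchE /=.
have -> : ((s, om) \in D) = (t0 <= s <= t).
  by rewrite in_setX/= mem_setE in_itv/= in_setT andbT.
by case: ifPn => _; rewrite ?mulr1 ?mulr0.
Qed.

Lemma cut_cut t0 s t f : s <= t ->
  cut t0 s f = fun z => (t0 <= z.1 <= s)%R%:R * cut t0 t f z.
Proof.
move=> st; apply/funext => z; rewrite /cut mulrCA -natrM mulnb.
congr (_ * (nat_of_bool _)%:R); case: (t0 <= z.1) => //=.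
by apply/idP/andP => [h|[]//]; split => //; exact: le_trans st.
Qed.

Lemma measurable_cut_le t0 s t f : s <= t -> measurable_fun setT (cut t0 t f) ->
  measurable_fun setT (cut t0 s f).
Proof.
move=> st mf; rewrite (cut_cut _ _ st); apply: measurable_funM mf.
exact: (measurableT_comp (measurable_time_indic t0 s)).
Qed.

Lemma norm_cut_le t0 s t f z : s <= t -> `|cut t0 s f z| <= `|cut t0 t f z|.
Proof.
move=> st; rewrite (cut_cut _ _ st) normrM ger0_norm// ler_piMl//.
by case: (_ <= _ <= _); rewrite ?ler01 ?lexx.
Qed.

Lemma cut_le t0 s t f : s <= t -> sqint nu (cut t0 t f) -> sqint nu (cut t0 s f).
Proof.
move=> st sf; have ms := measurable_cut_le st sf.1; apply: sqint_le ms _ sf.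
by move=> z; exact: norm_cut_le.
Qed.

Lemma int1_cut_le t0 s t f : s <= t -> int1 nu (cut t0 t f) -> int1 nu (cut t0 s f).
Proof.
move=> st sf; have ms := measurable_cut_le st (int1_meas sf); apply: int1_le ms _ sf.
by move=> z; exact: norm_cut_le.
Qed.

Lemma cutB t0 t f h z :
  cut t0 t (fun s om => f s om - h s om) z = cut t0 t f z - cut t0 t h z.
Proof. by rewrite /cut mulrBl. Qed.

Lemma cut_sqr t0 t f z : cut t0 t (fun s om => f s om ^+ 2) z = cut t0 t f z ^+ 2.
Proof. by rewrite /cut exprMn -natrX; case: (_ <= _ <= _). Qed.

Lemma cut_section t0 t f om : (fun s => cut t0 t f (s, om)) =
  (fun s => f s om) \_ `[t0, t].
Proof.
apply/funext => s; rewrite patchE /cut/=.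
have -> : (s \in `[t0, t]%classic) = (t0 <= s <= t) by rewrite mem_setE in_itv.
by case: ifPn => _; rewrite ?mulr1 ?mulr0.
Qed.

(** Tonelli turns the iterated integrals used by the definitions, with time inside, into integrals
    over the product space, where the L2 arguments take place. *)
Lemma ge0_iterated t0 t f : (forall s om, 0 <= f s om) ->
  measurable_fun setT (cut t0 t f) ->
  (\int[Pr]_om \int[mu]_(s in `[t0, t]) (f s om)%:E =
   \int[nu]_z (cut t0 t f z)%:E)%E.
Proof.
move=> f0 mf; rewrite fubini_tonelli2; last 2 first.
- exact/measurable_EFinP.
- by move=> z; rewrite lee_fin /cut mulr_ge0.
apply: eq_integral => om _; rewrite integral_mkcond /fubini_G.
apply: eq_integral => s _.
by have := congr1 (@^~ s) (cut_section t0 t f om) => /= ->; rewrite restrict_EFin.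
Qed.

Lemma iterated_sq t0 t f : sqint nu (cut t0 t f) ->
  (\int[Pr]_om \int[mu]_(s in `[t0, t]) (f s om ^+ 2)%:E =
   (\int[nu]_z (cut t0 t f z ^+ 2))%:E)%E.
Proof.
move=> sf; rewrite ge0_iterated; last 2 first.
- by move=> s om; exact: sqr_ge0.
- rewrite (_ : cut _ _ _ = fun z => cut t0 t f z ^+ 2).
    exact: measurable_funX sf.1.
  by apply/funext => z; rewrite cut_sqr.
rewrite /Rintegral fineK; last exact: (integrable_fin_num _ sf.2).
by apply: eq_integral => z _; rewrite cut_sqr.
Qed.

End Cut.

(** * The Ito integral *)

Section ItoIntegral.
Context {K : realType} {d : measure_display} {Omega : measurableType d}.
Variables (Pr : probability Omega K) (w : K -> Omega -> K) (t0 T : K).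
Hypotheses (hw : brownian_motion Pr w) (ht0 : 0 <= t0).
Local Notation mu := (@lebesgue_measure K).
Local Notation nu := (mu \x Pr)%E.
Local Notation simple := (simple_process w t0 T).
Local Notation ito := (ito_integral Pr w t0 T).
Implicit Types (f h : K -> Omega -> K) (I J : Omega -> K).
Implicit Types (g : nat -> @step_process K d Omega) (t s : K).
Implicit Types (p q : @step_process K d Omega).

(** The approximation clause of [ito_integral] in real integrals over the product space, with the
    sequence exposed so that it can be reused at another time. *)
Definition ito_approx t f I g : Prop :=
  [/\ forall k, simple (g k),
      (fun k => \int[nu]_z (cut t0 t (sp_eval (g k)) z - cut t0 t f z) ^+ 2)
        @ \oo --> (0 : K) &
      (fun k => \int[Pr]_om (sp_integral w (g k) t om - I om) ^+ 2)
        @ \oo --> (0 : K)].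

Lemma fine_cvg0 (u : nat -> K) : (EFin \o u) @ \oo --> 0%E <-> u @ \oo --> (0 : K).
Proof.
split=> [/fine_cvgP[_]//|u0]; apply/fine_cvgP; split => //; exact: nearW.
Qed.

Lemma eq_cvg_seq (V : topologicalType) (u v : nat -> V) (l : V) :
  u =1 v -> u @ \oo --> l -> v @ \oo --> l.
Proof. by move=> /funext ->. Qed.

(** [ito_integral] asks only that I be measurable; square-integrability follows because I is at
    finite distance from a square-integrable simple integral. *)
Lemma ito_integralP t f I : t0 <= t -> sqint nu (cut t0 t f) ->
  ito t f I <-> sqint Pr I /\ exists g, ito_approx t f I g.
Proof.
move=> t0t sf.
have sdiff k : simple k -> sqint nu (cut t0 t (fun s om => f s om - sp_eval k s om)).
  move=> sk; rewrite (_ : cut _ _ _ = fun z => cut t0 t f z - cut t0 t (sp_eval k) z).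
    exact: sqintB sf (sqint_cut_sp_eval hw ht0 t sk).
  by apply/funext => z; rewrite cutB.
have E1 k : simple k -> (\int[Pr]_om \int[mu]_(s in `[t0, t])
    ((f s om - sp_eval k s om) ^+ 2)%:E =
    (\int[nu]_z (cut t0 t (sp_eval k) z - cut t0 t f z) ^+ 2)%:E)%E.
  move=> /sdiff /iterated_sq ->; congr EFin; apply: eq_Rint => z.
  by rewrite cutB -sqrrN opprB.
have E2 k : sqint Pr I -> simple k ->
    (\int[Pr]_om ((I om - sp_integral w k t om) ^+ 2)%:E =
    (\int[Pr]_om (sp_integral w k t om - I om) ^+ 2)%:E)%E.
  move=> sI sk; have := sqintB (sqint_sp_integral hw ht0 sk t0t) sI.
  move=> [_ h]; rewrite /Rintegral fineK; last exact: (integrable_fin_num _ h).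
  by apply: eq_integral => om _; rewrite -sqrrN opprB.
split.
  move=> [mI [g [sg c1 c2]]].
  have sI : sqint Pr I.
    apply: (sqint_near mI _ c2) => k; exact: (sqint_sp_integral hw ht0 (sg k) t0t).
  split => //; exists g; split => //.
    by apply/fine_cvg0; apply: eq_cvg_seq c1 => k; rewrite E1.
  by apply/fine_cvg0; apply: eq_cvg_seq c2 => k; rewrite E2.
move=> [sI [g [sg /fine_cvg0 c1 /fine_cvg0 c2]]]; split; first exact: sI.1.
exists g; split => //.
  by apply: eq_cvg_seq c1 => k; rewrite /= E1.
by apply: eq_cvg_seq c2 => k; rewrite /= E2.
Qed.

Lemma cvg_seq_unique (u : nat -> K) (l : K) : u @ \oo --> l ->
  forall l' : K, u @ \oo --> l' -> l = l'.
Proof. by move=> h l' h'; exact: (cvg_unique _ h h'). Qed.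

Lemma Rint_sq_cst0 d' (D : measurableType d') (m : {measure set D -> \bar K})
    (f : D -> K) :
  (fun k : nat => \int[m]_x (f x - f x) ^+ 2) @ \oo --> (0 : K).
Proof.
rewrite (_ : (fun k => _) = fun=> 0); first exact: cvg_cst.
by apply/funext => k; rewrite -[RHS](Rint0 m); apply: eq_Rint => x; rewrite subrr expr0n.
Qed.

Lemma ito_isometry t f h I J : t0 <= t ->
  sqint nu (cut t0 t f) -> sqint nu (cut t0 t h) -> ito t f I -> ito t h J ->
  \int[Pr]_om (I om * J om) = \int[nu]_z (cut t0 t f z * cut t0 t h z).
Proof.
move=> t0t sf sh /(ito_integralP _ t0t sf)[sI [g [sg cg cI]]].
move=> /(ito_integralP _ t0t sh)[sJ [g' [sg' cg' cJ]]].
have sS k := sqint_sp_integral hw ht0 (sg k) t0t.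
have sS' k := sqint_sp_integral hw ht0 (sg' k) t0t.
have sC k := sqint_cut_sp_eval hw ht0 t (sg k).
have sC' k := sqint_cut_sp_eval hw ht0 t (sg' k).
apply: (cvg_seq_unique (Rint_mul_cvg sS sS' sI sJ cI cJ)).
apply: eq_cvg_seq (Rint_mul_cvg sC sC' sf sh cg cg') => k.
by rewrite (sp_isometry hw ht0 (sg k) (sg' k)).
Qed.

(** Supplies the mixed term when the distance between a simple integral and I is expanded; the
    simple factor is approximated by a constant sequence. *)
Lemma ito_isometry_simple t f I p0 : t0 <= t -> sqint nu (cut t0 t f) ->
  ito t f I -> simple p0 ->
  \int[Pr]_om (sp_integral w p0 t om * I om) =
  \int[nu]_z (cut t0 t (sp_eval p0) z * cut t0 t f z).
Proof.
move=> t0t sf /(ito_integralP _ t0t sf)[sI [g [sg cg cI]]] sg0.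
have sS k := sqint_sp_integral hw ht0 (sg k) t0t.
have sC k := sqint_cut_sp_eval hw ht0 t (sg k).
have sS0 := sqint_sp_integral hw ht0 sg0 t0t.
have sC0 := sqint_cut_sp_eval hw ht0 t sg0.
apply: (cvg_seq_unique (Rint_mul_cvg (fun=> sS0) sS sS0 sI (Rint_sq_cst0 _ _) cI)).
apply: eq_cvg_seq (Rint_mul_cvg (fun=> sC0) sC sC0 sf (Rint_sq_cst0 _ _) cg) => k.
by rewrite (sp_isometry hw ht0 sg0 (sg k)).
Qed.

(* Expand the square: by the isometry its three terms tend to A, - 2 A and A. *)
Lemma ito_approx_restrict s t f I J g : t0 <= s <= t -> sqint nu (cut t0 t f) ->
  ito_approx t f I g -> ito s f J -> ito_approx s f J g.
Proof.
move=> /andP[t0s st] sf [sg cg _] iJ.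
have sfs := cut_le st sf.
have [sJ _] := (ito_integralP _ t0s sfs).1 iJ.
have sS k := sqint_sp_integral hw ht0 (sg k) t0s.
have sC k := sqint_cut_sp_eval hw ht0 s (sg k).
have sCt k := sqint_cut_sp_eval hw ht0 t (sg k).
have c1 : (fun k => \int[nu]_z (cut t0 s (sp_eval (g k)) z - cut t0 s f z) ^+ 2)
        @ \oo --> (0 : K).
  apply: (squeeze_cvgr _ (cvg_cst 0) cg); apply: nearW => k.
  rewrite Rint_sq_ge0 /=; apply: le_Rintegral => //.
  - exact: (sqintB (sC k) sfs).2.
  - exact: (sqintB (sCt k) sf).2.
  - move=> z _; rewrite /cut -!mulrBl !exprMn ler_wpM2l ?sqr_ge0//.
    rewrite -!natrX ler_nat; case: (t0 <= z.1) => //=.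
    by case: (leP z.1 s) => //= zs; rewrite (le_trans zs st).
split => //.
have A1 := Rint_mul_cvg sC sC sfs sfs c1 c1.
have A2 := Rint_mul_cvg sC (fun=> sfs) sfs sfs c1 (Rint_sq_cst0 _ _).
set A := \int[nu]_z (cut t0 s f z * cut t0 s f z) in A1 A2.
have -> : (fun k => \int[Pr]_om (sp_integral w (g k) s om - J om) ^+ 2) =
  (fun k => \int[nu]_z (cut t0 s (sp_eval (g k)) z * cut t0 s (sp_eval (g k)) z)
    - 2 * (\int[nu]_z (cut t0 s (sp_eval (g k)) z * cut t0 s f z)) + A).
  apply/funext => k.
  rewrite (eq_Rint _ (g := fun om => (1 * sp_integral w (g k) s om - J om) ^+ 2));
    last by move=> om; rewrite mul1r.
  rewrite Rint_quad// expr1n mul1r mulr1 (ito_isometry_simple t0s sfs iJ (sg k)).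
  congr (_ - _ + _).
    by rewrite -(sp_isometry hw ht0 (sg k) (sg k))//; apply: eq_Rint => om; rewrite expr2.
  by rewrite /A -(ito_isometry t0s sfs sfs iJ iJ); apply: eq_Rint => om; rewrite expr2.
rewrite -[X in _ --> X](_ : A - 2 * A + A = 0); last by ring.
apply: cvgD; last exact: cvg_cst.
by apply: cvgB => //; apply: cvgMr.
Qed.

Lemma ito_martingale s t f I J z : t0 <= s <= t -> sqint nu (cut t0 t f) ->
  ito t f I -> ito s f J ->
  measurable_wrt (natural_filtration w 0 s) z -> sqint Pr z ->
  \int[Pr]_om (z om * I om) = \int[Pr]_om (z om * J om).
Proof.
move=> /[dup] sst /andP[t0s st] sf iI iJ hz sz.
have t0t := le_trans t0s st; have sfs := cut_le st sf.
have [sI [g gI]] := (ito_integralP _ t0t sf).1 iI.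
have [sJ _] := (ito_integralP _ t0s sfs).1 iJ.
(* One sequence now approximates both I and J, so the simple case applies index by index. *)
have [sg _ cJ] := ito_approx_restrict sst sf gI iJ.
have [_ _ cI] := gI.
have sS k := sqint_sp_integral hw ht0 (sg k) t0t.
have sSs k := sqint_sp_integral hw ht0 (sg k) t0s.
apply: (cvg_seq_unique (Rint_mul_cvg (fun=> sz) sS sz sI (Rint_sq_cst0 _ _) cI)).
apply: eq_cvg_seq (Rint_mul_cvg (fun=> sz) sSs sz sJ (Rint_sq_cst0 _ _) cJ) => k.
by rewrite (sp_martingale hw ht0 (sg k) sst).
Qed.

Definition sp_sub (g h : @step_process K d Omega) : step_process :=
  let pick {A} (a b : nat -> A) i :=
    if (i < sp_size g)%N then a i else b (i - sp_size g)%N in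
  StepProcess (sp_size g + sp_size h) (pick (sp_left g) (sp_left h))
    (pick (sp_right g) (sp_right h))
    (pick (sp_val g) (fun i om => - sp_val h i om)).

Lemma sp_sub_simple p0 q0 : simple p0 -> simple q0 -> simple (sp_sub p0 q0).
Proof.
move=> sg sh i /=; case: ifPn => [ig _|]; first exact: sg.
rewrite -leqNgt => gi ih; have [|? ? ? hv [c hc]] := sh (i - sp_size p0)%N.
  by rewrite ltn_subLR.
split => //; last by exists c => om; rewrite normrN.
rewrite (_ : (fun om => _) = (fun om => 0 - sp_val q0 (i - sp_size p0)%N om)).
  by apply: wrtB => //; exact: wrt_cst.
by apply/funext => om; rewrite sub0r.
Qed.

Lemma sp_sub_eval p0 q0 s om :
  sp_eval (sp_sub p0 q0) s om = sp_eval p0 s om - sp_eval q0 s om.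
Proof.
rewrite /sp_eval /= big_split_ord /= -sumrN; congr (_ + _); apply: eq_bigr => i _.
  by rewrite ltn_ord.
by rewrite ltnNge leq_addr /= addKn mulNr.
Qed.

Lemma sp_sub_integral p0 q0 t om :
  sp_integral w (sp_sub p0 q0) t om = sp_integral w p0 t om - sp_integral w q0 t om.
Proof.
rewrite /sp_integral /= big_split_ord /= -sumrN; congr (_ + _); apply: eq_bigr => i _.
  by rewrite ltn_ord.
by rewrite ltnNge leq_addr /= addKn mulNr.
Qed.

Lemma ito_integralB t f h I J : t0 <= t -> sqint nu (cut t0 t f) ->
  sqint nu (cut t0 t h) -> ito t f I -> ito t h J ->
  ito t (fun s om => f s om - h s om) (fun om => I om - J om).
Proof.
move=> t0t sf sh /(ito_integralP _ t0t sf)[sI [g [sg cg cI]]].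
move=> /(ito_integralP _ t0t sh)[sJ [g' [sg' cg' cJ]]].
have E : cut t0 t (fun s om => f s om - h s om) = fun z => cut t0 t f z - cut t0 t h z.
  by apply/funext => z; rewrite cutB.
apply/ito_integralP => //; first by rewrite E; exact: sqintB.
split; first exact: sqintB.
have sS k := sqint_sp_integral hw ht0 (sg k) t0t.
have sS' k := sqint_sp_integral hw ht0 (sg' k) t0t.
have sC k := sqint_cut_sp_eval hw ht0 t (sg k).
have sC' k := sqint_cut_sp_eval hw ht0 t (sg' k).
exists (fun k => sp_sub (g k) (g' k)); split.
- by move=> k; exact: sp_sub_simple.
- apply: eq_cvg_seq (Rint_sqB_cvg0 (fun k => sqintB (sC k) sf)
    (fun k => sqintB (sC' k) sh) cg cg') => k; apply: eq_Rint => z.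
  rewrite E; congr (_ ^+ 2); rewrite /cut sp_sub_eval; ring.
- apply: eq_cvg_seq (Rint_sqB_cvg0 (fun k => sqintB (sS k) sI)
    (fun k => sqintB (sS' k) sJ) cI cJ) => k; apply: eq_Rint => om.
  rewrite sp_sub_integral; congr (_ ^+ 2); ring.
Qed.

End ItoIntegral.

(** * The product rule in expectation *)

Lemma int1_ae_le d (D : measurableType d) (K : realType)
    (m1 : {measure set D -> \bar K}) (f g : D -> K) : measurable_fun setT f -> int1 m1 g ->
  {ae m1, forall x, `|f x| <= g x} -> int1 m1 f.
Proof.
move=> mf ig fg; apply/integrableP; split; first exact/measurable_EFinP.
have [mg ig'] := integrableP _ _ _ ig; apply: le_lt_trans ig'.
have m1' : measurable_fun setT (fun x => `|(f x)%:E|)%E.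
  by apply: measurableT_comp => //; exact/measurable_EFinP.
have m2' : measurable_fun setT (fun x => `|(g x)%:E|)%E by exact: measurableT_comp.
apply: ae_ge0_le_integral => //.
by apply: filterS fg => x h _; rewrite lee_fin (le_trans h)// ler_norm.
Qed.

(** * Sections of functions on a product *)

Section Sections.
Context d1 d2 (D1 : measurableType d1) (D2 : measurableType d2) (K : realType).
Variables (m1 : {sigma_finite_measure set D1 -> \bar K})
  (m2 : {sigma_finite_measure set D2 -> \bar K}).
Local Notation m12 := (m1 \x m2)%E.

(** [h] is only measurable, so the integral is split into those of the positive and negative parts,
    each measurable by Tonelli. This provides the joint measurability of drift primitives. *)
Lemma measurable_Rint_section (h : D1 * D2 -> K) : measurable_fun setT h ->
  measurable_fun setT (fun x => \int[m2]_y h (x, y)).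
Proof.
move=> mh; have mE : measurable_fun setT (EFin \o h) by exact/measurable_EFinP.
have mp : measurable_fun setT (fubini_F m2 (EFin \o h)^\+%E).
  by apply: measurable_fun_fubini_tonelli_F; [exact: measurable_funepos|exact: funepos_ge0].
have mn : measurable_fun setT (fubini_F m2 (EFin \o h)^\-%E).
  by apply: measurable_fun_fubini_tonelli_F; [exact: measurable_funeneg|exact: funeneg_ge0].
have e : (fun x => \int[m2]_y (h (x, y))%:E)%E =
    (fubini_F m2 (EFin \o h)^\+%E \- fubini_F m2 (EFin \o h)^\-%E)%E.
  apply/funext => x; rewrite integralE.
  congr (_ - _)%E; apply: eq_integral => y _.
    exact: (congr1 (@^~ y) (funepos_comp (EFin \o h) (pair x))).
  exact: (congr1 (@^~ y) (funeneg_comp (EFin \o h) (pair x))).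
have mF : measurable_fun setT (fun x => \int[m2]_y (h (x, y))%:E)%E.
  rewrite e; exact: emeasurable_funB.
by apply: (measurableT_comp _ mF); exact: fine_measurable.
Qed.

Lemma sqint_section1 (h : D1 * D2 -> K) : sqint m12 h ->
  {ae m1, forall x, sqint m2 (fun y => h (x, y))}.
Proof.
move=> [mh h2]; apply: filterS (int1_ae_section1 h2) => x hx; split => //.
exact: measurableT_comp (pair1_measurable x).
Qed.

Lemma sqint_section2 (h : D1 * D2 -> K) : sqint m12 h ->
  {ae m2, forall y, sqint m1 (fun x => h (x, y))}.
Proof.
move=> [mh h2]; apply: filterS (int1_ae_section2 h2) => x hx; split => //.
exact: measurableT_comp (pair2_measurable x).
Qed.

Lemma ae_snd (P : D2 -> Prop) : {ae m2, forall y, P y} ->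
  {ae m12, forall z, P z.2}.
Proof.
move=> [N [mN N0 hN]]; exists (setT `*` N); split.
- exact: measurableX.
- by rewrite product_measure1E// N0 mule0.
- by move=> [x y] /= h; split => //; apply: hN.
Qed.

End Sections.

(** * The drift integral as a process *)

Section Drift.
Context {K : realType} {d : measure_display} {Omega : measurableType d}.
Variables (Pr : probability Omega K) (t0 t : K).
Hypothesis t0t : t0 <= t.
Local Notation mu := (@lebesgue_measure K).
Local Notation nu := (mu \x Pr)%E.
Local Notation cut := (cut t0 t).
Implicit Types (a b : K -> Omega -> K) (s : K).

Definition primitive a s om : K := \int[mu]_(r in `[t0, s]) a r om.

Lemma cutE a om : (fun s : measurableTypeR K => cut a (s, om)) =
  (fun s => a s om) \_ [set` `[t0, t]].
Proof. exact: cut_section. Qed.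

Lemma cut_mul a b z : cut (fun s om => a s om * b s om) z = cut a z * cut b z.
Proof. by rewrite /cut; case: (_ <= _ <= _); rewrite ?mulr1 ?mulr0. Qed.

Lemma Rint_cut a om : \int[mu]_s cut a (s, om) = primitive a t om.
Proof.
rewrite /primitive [RHS]Rintegral_mkcond; apply: eq_Rint => s.
exact: (congr1 (@^~ s) (cutE a om)).
Qed.

Lemma primitive_cut a s om : s <= t ->
  primitive a s om = \int[mu]_r (cut a (r, om) * (r <= s)%R%:R).
Proof.
move=> st; rewrite /primitive Rintegral_mkcond; apply: eq_Rint => r.
rewrite -(restrict_mul_le (fun r => a r om) t0 st); congr (_ * _).
exact/esym/(congr1 (@^~ r) (cutE a om)).
Qed.

Lemma Rint_time_indic (p q : K) : p <= q ->
  int1 mu (fun s : measurableTypeR K => (p <= s <= q)%R%:R) /\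
  \int[mu]_s ((p <= s <= q)%R%:R : K) = q - p.
Proof.
move=> pq; have E : (fun s : K => (p <= s <= q)%R%:R : K) = \1_`[p, q].
  by apply/funext => s; rewrite indicE mem_setE in_itv.
rewrite E; split; first exact: integrable_indic_itv.
rewrite /Rintegral integral_indic// setIT.
have := lebesgue_measure_itv `[p, q]; rewrite /= lte_fin => e.
transitivity (fine (if p < q then (q%:E - p%:E)%E else 0%E)).
  by congr fine; exact: e.
case: ltP => //= qp; have -> : p = q by apply/le_anti; rewrite pq qp.
by rewrite subrr.
Qed.

Lemma sqint_time_indic (p q : K) : p <= q ->
  sqint mu (fun s : measurableTypeR K => (p <= s <= q)%R%:R).
Proof.
move=> pq; split; first exact: measurable_time_indic.
by apply: eq_int1 (Rint_time_indic pq).1 => s; rewrite -natrX; case: (_ <= _ <= _).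
Qed.

Lemma sqint_cut_cst (z : Omega -> K) : sqint Pr z -> sqint nu (cut (fun _ => z)).
Proof.
move=> sz; split.
  apply: measurable_funM; first exact: measurableT_comp sz.1 _.
  exact: (measurableT_comp (measurable_time_indic t0 t)).
apply: eq_int1 (Rint_tensor (Rint_time_indic t0t).1 sz.2).1 => p.
by rewrite exprMn -natrX mulrC; case: (_ <= _ <= _).
Qed.

(** The strip [t0, t] x Omega has finite measure, so its indicator is a square-integrable factor. *)
Lemma int1_cut a : sqint nu (cut a) -> int1 nu (cut a).
Proof.
move=> sa; have s1 : sqint Pr (fun=> 1).
  by split => //; apply: finite_measure_integrable_cst.
apply: eq_int1 (sqint_mul sa (sqint_cut_cst s1)) => p.
by rewrite /cut mul1r -mulrA -natrM; case: (_ <= _ <= _).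
Qed.

Lemma Rint_primitive a : int1 nu (cut a) ->
  int1 Pr (primitive a t) /\ \int[Pr]_om primitive a t om = \int[nu]_z cut a z.
Proof.
move=> /Rint_fubini2[h1 h2]; split.
  by apply: eq_int1 h1 => om; exact: Rint_cut.
by rewrite -h2; apply: eq_Rint => om; rewrite -Rint_cut.
Qed.

Let Q a om : K := \int[mu]_r cut a (r, om) ^+ 2.

(** Cauchy-Schwarz against the indicator of [t0, s], whose square integrates to s - t0 <= t - t0.
    One null set serves all s, which makes the bound usable on the product space. *)
Lemma primitive_bound a : sqint nu (cut a) -> {ae Pr, forall om,
  forall s, t0 <= s <= t -> primitive a s om ^+ 2 <= (t - t0) * Q a om}.
Proof.
move=> sa; apply: filterS (sqint_section2 sa) => om so s /andP[t0s st].
rewrite primitive_cut//.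
have -> : \int[mu]_r (cut a (r, om) * (r <= s)%R%:R) =
          \int[mu]_r (cut a (r, om) * (t0 <= r <= s)%R%:R).
  apply: eq_Rint => r; rewrite /cut/= -!mulrA -!natrM !mulnb.
  congr (_ * (nat_of_bool _)%:R).
  by case: (t0 <= r) => //=; rewrite andbC.
apply: le_trans (Rint_cauchy_schwarz so (sqint_time_indic t0s)) _.
rewrite mulrC ler_wpM2r ?Rint_sq_ge0//.
rewrite (eq_Rint _ (g := fun r : measurableTypeR K => (t0 <= r <= s)%R%:R)).
  by rewrite (Rint_time_indic t0s).2 lerB.
by move=> r; rewrite -natrX; case: (_ <= _ <= _).
Qed.

Lemma sqint_primitive a : sqint nu (cut a) -> sqint Pr (primitive a t).
Proof.
move=> sa; have mp := int1_meas (Rint_primitive (int1_cut sa)).1.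
split => //; apply: (int1_ae_le (g := fun om => (t - t0) * Q a om)).
- exact: measurable_funX.
- by apply: int1Z; exact: (Rint_fubini2 sa.2).1.
- apply: filterS (primitive_bound sa) => om h.
  by rewrite ger0_norm ?sqr_ge0// h// lexx t0t.
Qed.

Lemma measurable_cut_primitive a : measurable_fun setT (cut a) ->
  measurable_fun setT (cut (primitive a)).
Proof.
(* The moving upper limit becomes an indicator, so that the primitive is a section integral of a
   measurable function of ((s, om), r). *)
move=> ma; pose h (p : (measurableTypeR K * Omega) * measurableTypeR K) : K :=
  cut a (p.2, p.1.2) * (p.2 <= p.1.1)%R%:R.
have mh : measurable_fun setT h.
  apply: measurable_funM.
    apply: (measurableT_comp ma); apply: measurable_fun_pair => //.
    exact: measurableT_comp.
  have mb : measurable_fun setT (fun c : bool => c%:R : K) by [].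
  apply: (measurableT_comp mb); apply: measurable_fun_ler => //.
  exact: measurableT_comp.
have mR := measurable_Rint_section mu mh.
rewrite (_ : cut (primitive a) = fun p => (\int[mu]_r h (p, r)) * (t0 <= p.1 <= t)%R%:R).
  apply: measurable_funM => //.
  exact: (measurableT_comp (measurable_time_indic t0 t)).
apply/funext => -[s om]; rewrite /cut/=.
case: (boolP (t0 <= s <= t)) => [/andP[_ st]|_]; last by rewrite !mulr0.
by rewrite !mulr1 primitive_cut.
Qed.

Lemma sqint_cut_primitive a : sqint nu (cut a) -> sqint nu (cut (primitive a)).
Proof.
move=> sa; split; first exact: measurable_cut_primitive sa.1.
have iQ := int1Z (t - t0) (Rint_fubini2 sa.2).1.
apply: int1_ae_le (Rint_tensor (Rint_time_indic t0t).1 iQ).1 _.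
  by apply: measurable_funX; exact: measurable_cut_primitive sa.1.
apply: filterS (ae_snd mu (primitive_bound sa)) => -[s om] /= h.
rewrite ger0_norm ?sqr_ge0// /cut/= exprMn -natrX.
case: (boolP (t0 <= s <= t)) => [/h|_]; first by rewrite mulr1 mul1r.
by rewrite mulr0 mul0r.
Qed.

(** Integration by parts along each integrable path, hence almost surely, followed by Fubini. *)
Lemma Rint_primitive_mul a b : sqint nu (cut a) -> sqint nu (cut b) ->
  \int[Pr]_om (primitive a t om * primitive b t om) =
  \int[nu]_z (cut a z * cut (primitive b) z) +
  \int[nu]_z (cut (primitive a) z * cut b z).
Proof.
move=> sa sb.
have i1 := sqint_mul sa (sqint_cut_primitive sb).
have i2 := sqint_mul (sqint_cut_primitive sa) sb.
have [j1 <-] := Rint_fubini2 i1; have [j2 <-] := Rint_fubini2 i2.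
rewrite -(RintD j1 j2); apply: ae_eq_Rint.
- apply: measurable_funM; [exact: (sqint_primitive sa).1|exact: (sqint_primitive sb).1].
- exact: int1_meas (int1D j1 j2).
have ha := int1_ae_section2 (int1_cut sa); have hb := int1_ae_section2 (int1_cut sb).
apply: filterS2 ha hb => om ia ib.
have ia' : mu.-integrable `[t0, t] (EFin \o (fun s => a s om)).
  by apply/int1_restrict; rewrite -cutE.
have ib' : mu.-integrable `[t0, t] (EFin \o (fun s => b s om)).
  by apply/int1_restrict; rewrite -cutE.
have [_ _ e] := primitive_mul ia' ib'; apply: (etrans e); congr (_ + _).
  apply: etrans (esym (Rint_cut (fun s om => a s om * primitive b s om) om)) _.
  by apply: eq_Rint => s; exact: cut_mul.
apply: etrans (esym (Rint_cut (fun s om => primitive a s om * b s om) om)) _.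
by apply: eq_Rint => s; exact: cut_mul.
Qed.

End Drift.

(** * Mixed second moments of Ito processes *)

Section ExpectedProductRule.
Context {K : realType} {d : measure_display} {Omega : measurableType d}.
Variables (Pr : probability Omega K) (w : K -> Omega -> K) (t0 T : K).
Hypotheses (hw : brownian_motion Pr w) (ht0 : 0 <= t0).
Local Notation mu := (@lebesgue_measure K).
Local Notation nu := (mu \x Pr)%E.
Local Notation ito := (ito_integral Pr w t0 T).
Local Notation cut := (cut t0).
Local Notation prim := (primitive t0).
Implicit Types (a b f h X Y : K -> Omega -> K) (I J : Omega -> K) (s t x y : K).

(* dX = a dt + f dw on [t0, t], X(t0) = x0 *)
Record ito_process t x0 a f X : Prop := ItoProcess {
  ip_X : sqint nu (cut t X);
  ip_a : sqint nu (cut t a);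
  ip_f : sqint nu (cut t f);
  ip_adapted : forall s, t0 <= s <= t ->
    measurable_wrt (natural_filtration w t0 s) (a s);
  ip_meas : forall s, t0 <= s <= t -> measurable_fun setT (X s);
  ip_rep : forall s, t0 <= s <= t -> exists2 I, ito s f I &
    {ae Pr, forall om, X s om = x0 + prim a s om + I om} }.

Lemma sqint_cst (c : K) : sqint Pr (fun=> c).
Proof. by split => //; exact: finite_measure_integrable_cst. Qed.

Lemma ito_sqint t f I : t0 <= t -> sqint nu (cut t f) -> ito t f I -> sqint Pr I.
Proof. by move=> t0t sf /(ito_integralP T hw ht0 _ t0t sf)[]. Qed.

Lemma ito_start f I : sqint nu (cut t0 f) -> ito t0 f I ->
  \int[Pr]_om I om ^+ 2 = 0.
Proof.
move=> sf iI; rewrite (eq_Rint _ (fun om => expr2 (I om))).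
rewrite (ito_isometry hw ht0 (lexx t0) sf sf iI iI).
have := iterated_sq sf; rewrite (_ : (\int[Pr]_om _ = 0)%E).
  by move=> /(congr1 fine) /= ->; apply: eq_Rint => z; rewrite expr2.
rewrite -[RHS](integral0 Pr setT); apply: eq_integral => om _.
by rewrite set_itv1 integral_set1.
Qed.

(** The martingale property with z = 1 leads back to time t0; there the isometry over a single point
    gives second moment 0, hence mean 0 by Cauchy-Schwarz. *)
Lemma ip_mean0 t x0 a f X I : t0 <= t -> ito_process t x0 a f X -> ito t f I ->
  \int[Pr]_om I om = 0.
Proof.
move=> t0t ip iI; have sf := ip_f ip.
have [J iJ _] := ip_rep ip (s := t0) (introT andP (conj (lexx _) t0t)).
have sft := cut_le t0t sf.
have sJ := ito_sqint (lexx _) sft iJ.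
have := @ito_martingale _ _ _ _ _ t0 T hw ht0 t0 t f I J (fun=> 1).
rewrite lexx t0t => /(_ isT sf iI iJ (@wrt_cst K d Omega w 0 t0 1) (sqint_cst 1)) e.
have := Rint_mul_le (sqint_cst 1) sJ; rewrite -e (ito_start sft iJ) mulr0 sqrtr0.
rewrite normr_le0 => /eqP <-; by apply: eq_Rint => om; rewrite mul1r.
Qed.

(* E[a_s J_t] = E[a_s J_s] for s <= t, and J_s is expressed through Y_s, which
   unlike s |-> J_s is known to be jointly measurable. *)
Lemma drift_martingale t a y0 b h Y J : t0 <= t ->
  sqint nu (cut t a) ->
  (forall s, t0 <= s <= t -> measurable_wrt (natural_filtration w t0 s) (a s)) ->
  ito_process t y0 b h Y -> ito t h J ->
  \int[Pr]_om (prim a t om * J om) =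
  \int[nu]_z (cut t a z * cut t Y z) - y0 * (\int[nu]_z cut t a z) -
  \int[nu]_z (cut t a z * cut t (prim b) z).
Proof.
move=> t0t sa ha ip iJ.
have sY := ip_X ip; have sb := ip_a ip; have sh := ip_f ip.
have sJ := ito_sqint t0t sh iJ.
have sPb := sqint_cut_primitive t0t sb.
have iW := sqint_mul sa (sqint_cut_cst t0t sJ).
have iaY := sqint_mul sa sY; have ia := int1_cut t0t sa; have iaP := sqint_mul sa sPb.
have iV := int1B (int1B iaY (int1Z y0 ia)) iaP.
rewrite -(RintZ y0 ia) -(RintB iaY (int1Z y0 ia)).
rewrite -(RintB (int1B iaY (int1Z y0 ia)) iaP).
transitivity (\int[nu]_z (cut t a z * cut t (fun=> J) z)).
  have [j1 <-] := Rint_fubini2 iW; apply: ae_eq_Rint.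
  - by apply: measurable_funM; [exact: (sqint_primitive t0t sa).1|exact: sJ.1].
  - exact: int1_meas j1.
  - apply: filterS (int1_ae_section2 ia) => om ja.
    transitivity (\int[mu]_s (J om * cut t a (s, om))).
      by rewrite (RintZ _ ja) Rint_cut mulrC.
    apply: eq_Rint => s; rewrite -cut_mul /cut/=; ring.
(* With time as the outer variable, the expectations are compared for each s separately, so [Js] can
   be chosen anew for every s. *)
have [jW <-] := Rint_fubini1 iW; have [jV <-] := Rint_fubini1 iV.
apply: ae_eq_Rint; [exact: int1_meas jW|exact: int1_meas jV|].
apply: filterS3 (sqint_section1 sa) (sqint_section1 sY) (sqint_section1 sPb).
move=> s; rewrite /cut/=; case: (boolP (t0 <= s <= t)) => st; last first.
  by move=> _ _ _; apply: eq_Rint => om; rewrite !(mulr0, mul0r, subr0).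
have E z : (fun om => z om * true%:R) = z :> (Omega -> K).
  by apply/funext => om; rewrite mulr1.
rewrite !E => s1 s2 s3.
have /andP[t0s st'] := st.
have [Js iJs hYs] := ip_rep ip st.
have sJs := ito_sqint t0s (cut_le st' sh) iJs.
rewrite (eq_Rint _ (g := fun om => a s om * J om)); last by move=> om; rewrite !mulr1.
rewrite (ito_martingale hw ht0 st sh iJ iJs _ s1); last first.
  exact: wrt_le (ha _ st).
apply: ae_eq_Rint.
- by apply: measurable_funM; [exact: s1.1|exact: sJs.1].
- apply: measurable_funB; first apply: measurable_funB.
  + by apply: measurable_funM; rewrite E; [exact: s1.1|exact: s2.1].
  + by apply: measurable_funM => //; rewrite E; exact: s1.1.
  + by apply: measurable_funM; rewrite E; [exact: s1.1|exact: s3.1].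
- apply: filterS hYs => om ->; rewrite !mulr1; ring.
Qed.

(** Expand X Y with X = x0 + A + I and Y = y0 + B + J, where A and B are the drift integrals.
    [drift_martingale] turns E[A J] into E int a Y - y0 E int a - E int a B; the last two terms
    cancel y0 E[A] and one half of the integration by parts of E[A B]. E[B I] behaves alike, and
    E[I J] is the isometry. *)
Lemma expected_product t x0 a f X y0 b h Y : t0 <= t ->
  ito_process t x0 a f X -> ito_process t y0 b h Y ->
  [/\ sqint Pr (X t), sqint Pr (Y t) &
  \int[Pr]_om (X t om * Y t om) = x0 * y0 +
  \int[nu]_z (cut t a z * cut t Y z + cut t X z * cut t b z +
              cut t f z * cut t h z)].
Proof.
move=> t0t ip ip'.
have tt : t0 <= t <= t by rewrite t0t lexx.
have [I iI hX] := ip_rep ip tt; have [J iJ hY] := ip_rep ip' tt.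
have sI := ito_sqint t0t (ip_f ip) iI; have sJ := ito_sqint t0t (ip_f ip') iJ.
have sa := ip_a ip; have sb := ip_a ip'.
have sA := sqint_primitive t0t sa; have sB := sqint_primitive t0t sb.
have sX : sqint Pr (X t).
  apply: ae_eq_sqint (ip_meas ip tt) _ hX.
  by apply: sqintD => //; apply: sqintD => //; exact: sqint_cst.
have sY : sqint Pr (Y t).
  apply: ae_eq_sqint (ip_meas ip' tt) _ hY.
  by apply: sqintD => //; apply: sqintD => //; exact: sqint_cst.
split => //.
have iaY := sqint_mul sa (ip_X ip'); have iXb := sqint_mul (ip_X ip) sb.
have ifh := sqint_mul (ip_f ip) (ip_f ip').
rewrite (RintD (int1D iaY iXb) ifh) (RintD iaY iXb).
have iA := sqint_int1 sA; have iB := sqint_int1 sB.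
have jI := sqint_int1 sI; have jJ := sqint_int1 sJ.
have iAB := sqint_mul sA sB; have iAJ := sqint_mul sA sJ.
have iBI := sqint_mul sB sI; have iIJ := sqint_mul sI sJ.
have i1 : int1 Pr (fun=> x0 * y0) := sqint_int1 (sqint_cst (x0 * y0)).
have k1 := int1D i1 (int1Z x0 iB); have k2 := int1D (int1Z x0 jJ) (int1Z y0 iA).
have k3 := int1D (int1Z y0 jI) iAB; have k4 := int1D iAJ iBI.
transitivity (\int[Pr]_om ((x0 * y0 + x0 * prim b t om) + (x0 * J om + y0 * prim a t om) +
   ((y0 * I om + prim a t om * prim b t om) + (prim a t om * J om + prim b t om * I om))
   + I om * J om)).
  apply: ae_eq_Rint; first by apply: measurable_funM; [exact: sX.1|exact: sY.1].
    exact: int1_meas (int1D (int1D (int1D k1 k2) (int1D k3 k4)) iIJ).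
  by apply: filterS2 hX hY => om -> ->; ring.
rewrite (RintD (int1D (int1D k1 k2) (int1D k3 k4)) iIJ).
rewrite (RintD (int1D k1 k2) (int1D k3 k4)) (RintD k1 k2) (RintD k3 k4).
rewrite (RintD i1 (int1Z x0 iB)) (RintD (int1Z x0 jJ) (int1Z y0 iA)).
rewrite (RintD (int1Z y0 jI) iAB) (RintD iAJ iBI).
rewrite (RintZ x0 iB) (RintZ x0 jJ) (RintZ y0 iA) (RintZ y0 jI).
rewrite (ip_mean0 t0t ip iI) (ip_mean0 t0t ip' iJ).
rewrite (drift_martingale t0t sa (ip_adapted ip) ip' iJ).
rewrite (drift_martingale t0t sb (ip_adapted ip') ip iI).
rewrite (Rint_primitive_mul t0t sa sb).
rewrite (ito_isometry hw ht0 t0t (ip_f ip) (ip_f ip') iI iJ).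
rewrite (Rint_primitive (int1_cut t0t sa)).2 (Rint_primitive (int1_cut t0t sb)).2.
have -> : \int[Pr]_om (x0 * y0) = x0 * y0.
  rewrite Rintegral_cst//; have e : Pr setT = 1%E := probability_setT Pr.
  by rewrite -[RHS]mulr1; congr (_ * _); exact: (congr1 fine e).
rewrite (eq_Rint nu (fun z => mulrC (cut t X z) (cut t b z))).
rewrite (eq_Rint nu (fun z => mulrC (cut t (prim a) z) (cut t b z))).
ring.
Qed.

End ExpectedProductRule.

(** * Integration by parts with initial values *)

Section AffinePrimitives.
Context {K : realType}.
Local Notation mu := (@lebesgue_measure K).
Implicit Types (f g F G : measurableTypeR K -> K) (a b c e : K).

Lemma affine_primitive_mul f g F G a b c e : a <= b ->
  mu.-integrable `[a, b] (EFin \o f) -> mu.-integrable `[a, b] (EFin \o g) ->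
  (forall x, a <= x <= b -> F x = c + \int[mu]_(y in `[a, x]) f y) ->
  (forall x, a <= x <= b -> G x = e + \int[mu]_(y in `[a, x]) g y) ->
  [/\ mu.-integrable `[a, b] (EFin \o (fun x => f x * G x)),
      mu.-integrable `[a, b] (EFin \o (fun x => F x * g x)) &
      F b * G b = c * e + (\int[mu]_(x in `[a, b]) (f x * G x) +
                  \int[mu]_(x in `[a, b]) (F x * g x))].
Proof.
move=> ab fi gi hF hG; have [i1 i2 e12] := primitive_mul fi gi.
have mab : measurable (`[a, b]%classic : set (measurableTypeR K)) by exact: measurable_itv.
have bb : a <= b <= b by rewrite ab lexx.
have E1 : {in `[a, b]%classic, (fun x => e * f x + f x * \int[mu]_(y in `[a, x]) g y) =1
   (fun x => f x * G x)}.
  move=> x; rewrite inE/= in_itv/= => xab; rewrite hG//; ring.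
have E2 : {in `[a, b]%classic, (fun x => c * g x + (\int[mu]_(y in `[a, x]) f y) * g x) =1
   (fun x => F x * g x)}.
  move=> x; rewrite inE/= in_itv/= => xab; rewrite hF//; ring.
have j1 := integrableZl mab e fi; have j2 := integrableZl mab c gi.
split.
- have := integrableD mab j1 i1; apply: eq_integrable => // x xab.
  by rewrite /= -E1.
- have := integrableD mab j2 i2; apply: eq_integrable => // x xab.
  by rewrite /= -E2.
have e1 : \int[mu]_(x in `[a, b]) (f x * G x) = \int[mu]_(x in `[a, b])
    (e * f x + f x * \int[mu]_(y in `[a, x]) g y).
  by apply: eq_Rintegral => x xab; rewrite -E1.
have e2 : \int[mu]_(x in `[a, b]) (F x * g x) = \int[mu]_(x in `[a, b])
    (c * g x + (\int[mu]_(y in `[a, x]) f y) * g x).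
  by apply: eq_Rintegral => x xab; rewrite -E2.
rewrite e1 e2 (RintegralD mab j1 i1) (RintegralD mab j2 i2).
rewrite (RintegralZl _ mab fi) (RintegralZl _ mab gi) hF// hG//.
rewrite mulrDl !mulrDr e12; ring.
Qed.

(** The Riccati solution is given backward from T and the moments forward from t0; integrating by
    parts requires both as primitives from t0. *)
Lemma backward_primitive (g : measurableTypeR K -> K) (F : K -> K) a b c :
  mu.-integrable `[a, b] (EFin \o g) ->
  (forall x, a <= x <= b -> F x = c + \int[mu]_(y in `[x, b]) g y) ->
  forall x, a <= x <= b -> F x = F a + \int[mu]_(y in `[a, x]) (- g y).
Proof.
move=> gi hF x /andP[ax xb].
have ab := le_trans ax xb.
have mab : measurable (`[a, b]%classic : set (measurableTypeR K)) by exact: measurable_itv.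
have max : measurable (`[a, x]%classic : set (measurableTypeR K)) by exact: measurable_itv.
have iax : mu.-integrable `[a, x] (EFin \o g).
  apply: (integrableS mab max _ gi).
  by move=> y /=; rewrite !in_itv/= => /andP[-> yx]; exact: le_trans xb.
rewrite hF ?ax// hF ?lexx// -addrA; congr (_ + _).
have -> : \int[mu]_(y in `[a, x]) (- g y) = - \int[mu]_(y in `[a, x]) g y.
  rewrite -mulN1r -(RintegralZl _ max iax); apply: eq_Rintegral => y _.
  by rewrite mulN1r.
have ixb : mu.-integrable `]x, b] (EFin \o g).
  apply: (integrableS mab _ _ gi); first exact: measurable_itv.
  by move=> y /=; rewrite !in_itv/= => /andP[/ltW xy ->]; rewrite (le_trans ax).
rewrite -(Rintegral_itv_obnd_cbnd ixb).
exact/esym/(Rintegral_itvB gi).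
Qed.

End AffinePrimitives.

Lemma ae_forall_fin d (D : measurableType d) (K : realType)
    (m : {measure set D -> \bar K}) (I : finType) (P : I -> D -> Prop) :
  (forall i, {ae m, forall x, P i x}) -> {ae m, forall x, forall i, P i x}.
Proof.
move=> h; suff : {ae m, forall x, forall i, i \in enum I -> P i x}.
  by apply: filterS => x hx i; apply: hx; rewrite mem_enum.
elim: (enum I) => [|i s ih]; first exact: filterE.
apply: filterS2 (h i) ih => x hi hs j; rewrite inE => /predU1P[->//|]; exact: hs.
Qed.

(** * Coordinates of vector processes *)

Section Components.
Context {K : realType} {d : measure_display} {Omega : measurableType d}.
Variables (Pr : probability Omega K) (w : K -> Omega -> K) (t0 T : K).
Hypotheses (hw : brownian_motion Pr w) (ht0 : 0 <= t0) (htT : t0 <= T).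
Local Notation mu := (@lebesgue_measure K).
Local Notation nu := (mu \x Pr)%E.
Local Notation cut := (cut t0).

Definition coord {p} (x : K -> Omega -> 'cV[K]_p) i s om : K := x s om i 0.

Lemma sqnormE p (v : 'cV[K]_p) : sqnorm v = \sum_i v i 0 ^+ 2.
Proof. by rewrite /sqnorm mxE; apply: eq_bigr => i _; rewrite mxE expr2. Qed.

Lemma L2_adapted_sqint p (x : K -> Omega -> 'cV[K]_p) i :
  L2_adapted Pr w t0 T x -> sqint nu (cut T (coord x i)).
Proof.
move=> [mx _ fx].
have mc j : measurable_fun setT (cut T (coord x j)).
  by apply: measurable_cut (lexx T) _; exact: mx.
split => //.
have E z : cut T (fun s om => sqnorm (x s om)) z = \sum_j cut T (coord x j) z ^+ 2.
  rewrite /cut sqnormE mulr_suml; apply: eq_bigr => j _.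
  by rewrite exprMn -natrX; case: (_ <= _ <= _).
have mS : measurable_fun setT (cut T (fun s om => sqnorm (x s om))).
  rewrite (_ : cut T _ = fun z => \sum_j cut T (coord x j) z ^+ 2); last exact/funext.
  by apply: measurable_sum => j; exact: measurable_funX.
have S0 z : 0 <= cut T (fun s om => sqnorm (x s om)) z.
  by rewrite E sumr_ge0// => j _; exact: sqr_ge0.
have iS : int1 nu (cut T (fun s om => sqnorm (x s om))).
  apply/integrableP; split; first exact/measurable_EFinP.
  move: fx; rewrite ge0_iterated//; last first.
    by move=> s om; rewrite sqnormE sumr_ge0// => j _; exact: sqr_ge0.
  apply: le_lt_trans; rewrite le_eqVlt; apply/orP; left; apply/eqP.
  by apply: eq_integral => z _; rewrite /= ger0_norm.
apply: int1_le iS; first exact: measurable_funX.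
move=> z; rewrite ger0_norm ?sqr_ge0// ger0_norm// E (bigD1 i)//= lerDl.
by rewrite sumr_ge0// => j _; exact: sqr_ge0.
Qed.

Lemma sqint_cut_coef (m : K -> K) (f : K -> Omega -> K) :
  measurable_fun `[t0, T] m -> (exists c, forall t, t0 <= t <= T -> `|m t| <= c) ->
  sqint nu (cut T f) -> sqint nu (cut T (fun s om => m s * f s om)).
Proof.
move=> mm [c mc] sf.
pose m' : measurableTypeR K -> K := m \_ `[t0, T].
have mab : measurable (`[t0, T]%classic : set (measurableTypeR K)) by exact: measurable_itv.
have mm' : measurable_fun setT m' by apply/(measurable_restrictT _ mab).
have E : cut T (fun s om => m s * f s om) = fun z => m' z.1 * cut T f z.
  apply/funext => z; rewrite /cut /m' patchE.
  have -> : (z.1 \in `[t0, T]%classic) = (t0 <= z.1 <= T) by rewrite mem_setE in_itv.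
  by case: (_ <= _ <= _); rewrite ?mulr0 ?mulr1.
(* The bound has to hold off [t0, T] as well, where [m'] is 0, hence the maximum with 0. *)
rewrite E; apply: (sqint_bounded_mul (c := Num.max c 0)) sf.
  exact: (measurableT_comp mm').
move=> z; rewrite /m' patchE.
have -> : (z.1 \in `[t0, T]%classic) = (t0 <= z.1 <= T) by rewrite mem_setE in_itv.
by case: ifPn => [/mc h|_]; rewrite le_max ?h// normr0 lexx orbT.
Qed.

Lemma sqint_cutD (f h : K -> Omega -> K) : sqint nu (cut T f) -> sqint nu (cut T h) ->
  sqint nu (cut T (fun s om => f s om + h s om)).
Proof.
move=> sf sh; rewrite (_ : cut T _ = fun z => cut T f z + cut T h z).
  exact: sqintD.
by apply/funext => z; rewrite /cut mulrDl.
Qed.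

Lemma sqint_cut_sum (I : Type) (r : seq I) (f : I -> K -> Omega -> K) :
  (forall i, sqint nu (cut T (f i))) ->
  sqint nu (cut T (fun s om => \sum_(i <- r) f i s om)).
Proof.
move=> sf; rewrite (_ : cut T _ = fun z => \sum_(i <- r) cut T (f i) z).
  exact: sqint_sum.
by apply/funext => z; rewrite /cut mulr_suml.
Qed.

Lemma sqint_cut_mulmx p q (M : K -> 'M[K]_(p, q)) (x : K -> Omega -> 'cV[K]_q) i :
  bounded_measurable t0 T M -> (forall j, sqint nu (cut T (coord x j))) ->
  sqint nu (cut T (coord (fun s om => M s *m x s om) i)).
Proof.
move=> bM sx; rewrite (_ : coord _ i = fun s om => \sum_j M s i j * coord x j s om).
  apply: sqint_cut_sum => j; have [mM [c Mc]] := bM i j.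
  by apply: sqint_cut_coef => //; exists c.
by apply/funext => s; apply/funext => om; rewrite /coord mxE.
Qed.

Lemma wrt_mulmx p q (M : 'M[K]_(p, q)) (x : Omega -> 'cV[K]_q) s i :
  (forall j, measurable_wrt (natural_filtration w t0 s) (fun om => x om j 0)) ->
  measurable_wrt (natural_filtration w t0 s) (fun om => (M *m x om) i 0).
Proof.
move=> hx; rewrite (_ : (fun om => _) = fun om => \sum_j M i j * x om j 0).
  by apply: wrt_sum => j; apply: wrtM => //; exact: wrt_cst.
by apply/funext => om; rewrite mxE.
Qed.

Definition bil {p q} (M : 'M[K]_(p, q)) (x : 'cV[K]_p) (y : 'cV[K]_q) : K :=
  (x^T *m M *m y) 0 0.

Lemma bilE p q (M : 'M[K]_(p, q)) x y : bil M x y = \sum_i x i 0 * (M *m y) i 0.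
Proof. by rewrite /bil -mulmxA mxE; apply: eq_bigr => i _; rewrite mxE. Qed.

Lemma bil_sum p q (M : 'M[K]_(p, q)) x y :
  bil M x y = \sum_i \sum_j M i j * (x i 0 * y j 0).
Proof.
rewrite bilE; apply: eq_bigr => i _; rewrite mxE mulr_sumr.
by apply: eq_bigr => j _; rewrite mulrCA.
Qed.

Lemma int1_cut_bil p q (M : K -> 'M[K]_(p, q)) (x : K -> Omega -> 'cV[K]_p)
    (y : K -> Omega -> 'cV[K]_q) :
  bounded_measurable t0 T M -> (forall i, sqint nu (cut T (coord x i))) ->
  (forall j, sqint nu (cut T (coord y j))) ->
  int1 nu (cut T (fun s om => bil (M s) (x s om) (y s om))).
Proof.
move=> bM sx sy.
have h i := sqint_mul (sx i) (sqint_cut_mulmx i bM sy).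
apply: eq_int1 (int1_sum (index_enum _) h) => z.
rewrite {3}/cut bilE mulr_suml; apply: eq_bigr => i _.
by rewrite -cut_mul.
Qed.

Lemma int1_bil p q (M : 'M[K]_(p, q)) (x : Omega -> 'cV[K]_p) (y : Omega -> 'cV[K]_q) :
  (forall i, sqint Pr (fun om => x om i 0)) -> (forall j, sqint Pr (fun om => y om j 0)) ->
  int1 Pr (fun om => bil M (x om) (y om)) /\
  \int[Pr]_om bil M (x om) (y om) =
    \sum_i \sum_j M i j * \int[Pr]_om (x om i 0 * y om j 0).
Proof.
move=> sx sy.
have h i j := int1Z (M i j) (sqint_mul (sx i) (sy j)).
have E : (fun om => bil M (x om) (y om)) =
    (fun om => \sum_i \sum_j M i j * (x om i 0 * y om j 0)).
  by apply/funext => om; rewrite bil_sum.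
rewrite E; split; first by apply: int1_sum => i; exact: int1_sum.
rewrite Rint_sum; last by move=> i; exact: int1_sum.
apply: eq_bigr => i _; rewrite Rint_sum//; apply: eq_bigr => j _.
by rewrite RintZ//; exact: sqint_mul.
Qed.


(** The integrand on the right is the same for all t, so the product rule at every t exhibits a
    moment as a primitive. *)
Lemma Rint_cut_time (f : K -> Omega -> K) : int1 nu (cut T f) ->
  mu.-integrable `[t0, T] (EFin \o (fun s : measurableTypeR K => \int[Pr]_om f s om)) /\
  forall t, t0 <= t <= T ->
    \int[nu]_z cut t f z = \int[mu]_(s in `[t0, t]) \int[Pr]_om f s om.
Proof.
move=> fi.
have E t : (fun s : measurableTypeR K => \int[Pr]_om cut t f (s, om)) =
    (fun s => \int[Pr]_om f s om) \_ [set` `[t0, t]].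
  apply/funext => s; rewrite patchE /cut/=.
  have -> : (s \in `[t0, t]%classic) = (t0 <= s <= t) by rewrite mem_setE in_itv.
  case: ifPn => _; first by apply: eq_Rint => om; rewrite mulr1.
  by rewrite -[RHS](Rint0 Pr); apply: eq_Rint => om; rewrite mulr0.
split.
  by apply/int1_restrict; rewrite -E; exact: (Rint_fubini1 fi).1.
move=> t /andP[t0t tT].
have ft := int1_cut_le tT fi.
rewrite -(Rint_fubini1 ft).2 [RHS]Rintegral_mkcond.
by apply: eq_Rint => s; exact: (congr1 (@^~ s) (E t)).
Qed.

Lemma ae_sections p (x : K -> Omega -> 'cV[K]_p) :
  (forall i, sqint nu (cut T (coord x i))) ->
  {ae mu, forall s, t0 <= s <= T -> forall i, sqint Pr (coord x i s)}.
Proof.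
move=> sx.
have h i : {ae mu, forall s, t0 <= s <= T -> sqint Pr (coord x i s)}.
  apply: filterS (sqint_section1 (sx i)) => s; rewrite /cut/= => hs st.
  move: hs; rewrite st; congr (sqint _ _).
  by apply/funext => om; rewrite mulr1.
by apply: filterS (ae_forall_fin h) => s hs st i; exact: hs.
Qed.

End Components.

(** * The linear-quadratic problem *)

Section BilinearAlgebra.
Context {K : realType}.

Lemma bilDl p q (M : 'M[K]_(p, q)) x x' y : bil M (x + x') y = bil M x y + bil M x' y.
Proof. by rewrite /bil linearD/= !mulmxDl mxE. Qed.

Lemma bilDr p q (M : 'M[K]_(p, q)) x y y' : bil M x (y + y') = bil M x y + bil M x y'.
Proof. by rewrite /bil mulmxDr mxE. Qed.

Lemma bilMD p q (M N : 'M[K]_(p, q)) x y : bil (M + N) x y = bil M x y + bil N x y.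
Proof. by rewrite /bil mulmxDr mulmxDl mxE. Qed.

Lemma bilMN p q (M : 'M[K]_(p, q)) x y : bil (- M) x y = - bil M x y.
Proof. by rewrite /bil mulmxN mulNmx mxE. Qed.

Lemma bilNl p q (M : 'M[K]_(p, q)) x y : bil M (- x) y = - bil M x y.
Proof. by rewrite /bil linearN/= !mulNmx mxE. Qed.

Lemma bilNr p q (M : 'M[K]_(p, q)) x y : bil M x (- y) = - bil M x y.
Proof. by rewrite /bil mulmxN mxE. Qed.

Lemma bil_mull p q r (M : 'M[K]_(p, q)) (N : 'M[K]_(p, r)) x y :
  bil M (N *m x) y = bil (N^T *m M) x y.
Proof. by rewrite /bil trmx_mul !mulmxA. Qed.

Lemma bil_mulr p q r (M : 'M[K]_(p, q)) (N : 'M[K]_(q, r)) x y :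
  bil M x (N *m y) = bil (M *m N) x y.
Proof. by rewrite /bil !mulmxA. Qed.

Lemma bil0l p q (M : 'M[K]_(p, q)) y : bil M 0 y = 0.
Proof. by rewrite /bil trmx0 !mul0mx mxE. Qed.

Lemma bil_sym p (M : 'M[K]_p) x y : M^T = M -> bil M x y = bil M y x.
Proof.
move=> sM; rewrite /bil -[LHS](_ : (x^T *m M *m y)^T 0 0 = _); last by rewrite mxE.
by rewrite !trmx_mul trmxK sM mulmxA.
Qed.

Lemma quadE p (M : 'M[K]_p) x : quad M x = bil M x x.
Proof. by []. Qed.

End BilinearAlgebra.

(** * Completing the square with the Riccati equation *)

Section Completion.
Context {K : realType} {n m : nat}.
Variables (L : lq_data K n m) (P : K -> 'M[K]_n) (t : K).
Local Notation A := (lqA L t).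
Local Notation B := (lqB L t).
Local Notation Ab := (lqAb L t).
Local Notation Bb := (lqBb L t).
Local Notation Q := (lqQ L t).
Local Notation R := (lqR L t).
Local Notation U := (Upsilon L P t).
Local Notation G := (Gamma L P t).

Lemma regular_mpinv : (G^T <= U^T)%MS -> U *m mpinv U *m G = G.
Proof.
move=> /submxP[D hD]; have hG : G = U *m D^T by rewrite -[LHS]trmxK hD trmx_mul trmxK.
by have [h _ _ _] := mpinvP U; rewrite [in LHS]hG mulmxA h -hG.
Qed.

Lemma feedback_stationary (u z : 'cV[K]_m) (x : 'cV[K]_n) : U *m mpinv U *m G = G ->
  u = - (mpinv U *m G *m x) + null_proj L P t *m z -> U *m u + G *m x = 0.
Proof.
move=> hG ->; have [h _ _ _] := mpinvP U.
have e1 : U *m (mpinv U *m G *m x) = G *m x by rewrite !mulmxA hG.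
have e2 : U *m (null_proj L P t *m z) = 0.
  by rewrite /null_proj mulmxA mulmxBr mulmx1 mulmxA h subrr mul0mx.
by rewrite mulmxDr mulmxN e1 e2 addr0 addNr.
Qed.

(* The Riccati equation completes the square: the left-hand side is
   (u + U^+ G x)' U (v + U^+ G y), and U (u + U^+ G x) = U u + G x. *)
Lemma completion (u v : 'cV[K]_m) (x y : 'cV[K]_n) :
  (P t)^T = P t -> R^T = R -> U *m mpinv U *m G = G ->
  U *m u + G *m x = 0 ->
  bil (P t) (A *m x + B *m u) y + bil (P t) x (A *m y + B *m v) +
  bil (P t) (Ab *m x + Bb *m u) (Ab *m y + Bb *m v) -
  bil (riccati L P t) x y + bil Q x y + bil R u v = 0.
Proof.
move=> sP sR hG h0.
have sU : U^T = U by rewrite /Upsilon linearD/= !trmx_mul trmxK sP sR mulmxA.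
have GT : G^T = P t *m B + Ab^T *m P t *m Bb.
  by rewrite /Gamma linearD/= !trmx_mul !trmxK sP mulmxA.
(* Half of (U u + G x)' (v + U^+ G y) = 0: the pairing with v here, with U^+ G y in [h2]. *)
have h1 : bil G^T x v + bil U u v = 0.
  have : bil 1%:M (U *m u + G *m x) v = 0 by rewrite h0 bil0l.
  by rewrite bilDl !bil_mull !mulmx1 sU addrC.
have h2 : bil (G^T *m mpinv U *m G) x y + bil G u y = 0.
  have : bil (mpinv U *m G) (U *m u + G *m x) y = 0 by rewrite h0 bil0l.
  by rewrite bilDl !bil_mull sU !mulmxA hG addrC.
have hGx : bil G^T x v = bil (P t *m B) x v + bil (Ab^T *m P t *m Bb) x v.
  by rewrite GT bilMD.
have hGy : bil G u y = bil (B^T *m P t) u y + bil (Bb^T *m P t *m Ab) u y.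
  by rewrite /Gamma bilMD.
have hU : bil U u v = bil R u v + bil (Bb^T *m P t *m Bb) u v.
  by rewrite /Upsilon bilMD.
have hRic : bil (riccati L P t) x y = bil (A^T *m P t) x y + bil (P t *m A) x y +
    bil (Ab^T *m P t *m Ab) x y + bil Q x y - bil (G^T *m mpinv U *m G) x y.
  by rewrite /riccati !bilMD bilMN.
rewrite hRic !(bilDl, bilDr) !bil_mull !bil_mulr.
rewrite hGx hU in h1; rewrite hGy in h2.
lra.
Qed.

End Completion.

Lemma ae_and d (D : measurableType d) (K : realType)
    (m : {measure set D -> \bar K}) (P Q : D -> Prop) :
  {ae m, forall x, P x} -> {ae m, forall x, Q x} -> {ae m, forall x, P x /\ Q x}.
Proof. exact: filterI. Qed.

Lemma Rintegral_sum_on d (D0 : measurableType d) (K : realType)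
    (m : {measure set D0 -> \bar K}) (D : set D0) (I : Type) (r : seq I)
    (F : I -> D0 -> K) : measurable D ->
  (forall i, m.-integrable D (EFin \o F i)) ->
  m.-integrable D (EFin \o (fun s => \sum_(i <- r) F i s)) /\
  \int[m]_(s in D) (\sum_(i <- r) F i s) = \sum_(i <- r) \int[m]_(s in D) F i s.
Proof.
move=> mD hF; elim: r => [|i r [ih1 ih2]].
  rewrite big_nil; have -> : (fun s => \sum_(i <- [::]) F i s) = fun=> 0.
    by apply/funext => s; rewrite big_nil.
  by split; [exact: integrable0|rewrite /Rintegral integral0].
have -> : (fun s => \sum_(i <- i :: r) F i s) = fun s => F i s + \sum_(i <- r) F i s.
  by apply/funext => s; rewrite big_cons.
split; first exact: (integrableD mD (hF i) ih1).
by rewrite big_cons -ih2 -(RintegralD mD (hF i) ih1).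
Qed.

(** * The polarized cost along two states *)

Section LinearQuadratic.
Context {K : realType} {d : measure_display} {Omega : measurableType d}.
Variables (Pr : probability Omega K) (w : K -> Omega -> K) (t0 T : K).
Hypotheses (hw : brownian_motion Pr w) (ht0 : 0 <= t0) (htT : t0 <= T).
Local Notation mu := (@lebesgue_measure K).
Local Notation nu := (mu \x Pr)%E.
Local Notation cut := (cut t0).
Context {n m : nat}.
Variable L : lq_data K n m.
Local Notation A := (lqA L).
Local Notation B := (lqB L).
Local Notation Ab := (lqAb L).
Local Notation Bb := (lqBb L).
Local Notation Q := (lqQ L).
Local Notation R := (lqR L).
Hypotheses (hA : bounded_measurable t0 T A) (hB : bounded_measurable t0 T B)
  (hAb : bounded_measurable t0 T Ab) (hBb : bounded_measurable t0 T Bb)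
  (hQ : bounded_measurable t0 T Q) (hR : bounded_measurable t0 T R).
Local Notation adm := (admissible Pr w t0 T).
Local Notation state := (state L Pr w t0 T).

Definition drift (x : K -> Omega -> 'cV[K]_n) (u : K -> Omega -> 'cV[K]_m) s om :=
  A s *m x s om + B s *m u s om.
Definition diffusion (x : K -> Omega -> 'cV[K]_n) (u : K -> Omega -> 'cV[K]_m) s om :=
  Ab s *m x s om + Bb s *m u s om.

Implicit Types (x y : K -> Omega -> 'cV[K]_n) (u v : K -> Omega -> 'cV[K]_m).

Lemma state_ito_process (x0 : 'cV[K]_n) u x i t :
  adm u -> state x0 u x -> t0 <= t <= T ->
  ito_process Pr w t0 T t (x0 i 0) (coord (drift x u) i)
    (coord (diffusion x u) i) (coord x i).
Proof.
move=> au [ax _ rep] /andP[t0t tT].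
have sx j := L2_adapted_sqint j ax; have su j := L2_adapted_sqint j au.
have sa : sqint nu (cut T (coord (drift x u) i)).
  rewrite (_ : coord _ i = fun s om => coord (fun s om => A s *m x s om) i s om +
     coord (fun s om => B s *m u s om) i s om).
    by apply: sqint_cutD; exact: sqint_cut_mulmx.
  by apply/funext => s; apply/funext => om; rewrite /coord/drift mxE.
have sf : sqint nu (cut T (coord (diffusion x u) i)).
  rewrite (_ : coord _ i = fun s om => coord (fun s om => Ab s *m x s om) i s om +
     coord (fun s om => Bb s *m u s om) i s om).
    by apply: sqint_cutD; exact: sqint_cut_mulmx.
  by apply/funext => s; apply/funext => om; rewrite /coord/diffusion mxE.
have [_ wx _] := ax; have [_ wu _] := au.
split.
- exact: cut_le tT (sx i).
- exact: cut_le tT sa.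
- exact: cut_le tT sf.
- move=> s /andP[t0s st].
  have sT : t0 <= s <= T by rewrite t0s (le_trans st).
  rewrite (_ : coord _ i s = fun om => (A s *m x s om) i 0 + (B s *m u s om) i 0).
    by apply: wrtD; apply: wrt_mulmx => j; [exact: wx|exact: wu].
  by apply/funext => om; rewrite /coord/drift mxE.
- move=> s /andP[t0s st]; apply: (wrt_measurable hw ht0 (wx s i _)).
  by rewrite t0s (le_trans st).
- move=> s /andP[t0s st].
  have [|I iI hI] := rep s i; first by rewrite t0s (le_trans st).
  by exists I.
Qed.

Lemma drift_sections x u (s : K) :
  (forall i, sqint Pr (coord x i s)) -> (forall i, sqint Pr (coord u i s)) ->
  forall i, sqint Pr (coord (drift x u) i s) /\ sqint Pr (coord (diffusion x u) i s).
Proof.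
move=> sx su i.
have h p q (M : 'M[K]_(p, q)) (X : Omega -> 'cV[K]_q) j :
    (forall k, sqint Pr (fun om => X om k 0)) -> sqint Pr (fun om => (M *m X om) j 0).
  move=> sX; rewrite (_ : (fun om => _) = fun om => \sum_k M j k * X om k 0).
    by apply: sqint_sum => k; exact: sqintZ.
  by apply/funext => om; rewrite mxE.
split.
  rewrite (_ : coord _ i s = fun om => (A s *m x s om) i 0 + (B s *m u s om) i 0).
    by apply: sqintD; exact: h.
  by apply/funext => om; rewrite /coord/drift mxE.
rewrite (_ : coord _ i s = fun om => (Ab s *m x s om) i 0 + (Bb s *m u s om) i 0).
  by apply: sqintD; exact: h.
by apply/funext => om; rewrite /coord/diffusion mxE.
Qed.

Lemma state_final_sqint (x0 : 'cV[K]_n) u x i :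
  adm u -> state x0 u x -> sqint Pr (coord x i T).
Proof.
move=> au sx; have TT : t0 <= T <= T by rewrite htT lexx.
have ip := state_ito_process i au sx TT.
by have [] := expected_product hw ht0 htT ip ip.
Qed.

(** The time derivative, almost everywhere, of E[x_i y_j] according to the product rule. *)
Definition moment_rate x u y v i j (s : K) : K := \int[Pr]_om
  (coord (drift x u) i s om * coord y j s om + coord x i s om * coord (drift y v) j s om +
   coord (diffusion x u) i s om * coord (diffusion y v) j s om).

Lemma moment_primitive (x0 y0 : 'cV[K]_n) u x v y i j :
  adm u -> state x0 u x -> adm v -> state y0 v y ->
  mu.-integrable `[t0, T] (EFin \o (moment_rate x u y v i j : measurableTypeR K -> K)) /\
  forall t, t0 <= t <= T -> \int[Pr]_om (coord x i t om * coord y j t om) =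
    x0 i 0 * y0 j 0 + \int[mu]_(s in `[t0, t]) moment_rate x u y v i j s.
Proof.
move=> au sx av sy.
have TT : t0 <= T <= T by rewrite htT lexx.
have ix := state_ito_process i au sx; have iy := state_ito_process j av sy.
pose f s om := coord (drift x u) i s om * coord y j s om +
  coord x i s om * coord (drift y v) j s om +
  coord (diffusion x u) i s om * coord (diffusion y v) j s om.
have Ef t z : cut t f z = cut t (coord (drift x u) i) z * cut t (coord y j) z +
   cut t (coord x i) z * cut t (coord (drift y v) j) z +
   cut t (coord (diffusion x u) i) z * cut t (coord (diffusion y v) j) z.
  by rewrite -!cut_mul /cut/= -!mulrDl.
have fi : int1 nu (cut T f).
  apply: eq_int1 (fun z => esym (Ef T z)) _.
  apply: int1D; first apply: int1D.
  - exact: sqint_mul (ip_a (ix _ TT)) (ip_X (iy _ TT)).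
  - exact: sqint_mul (ip_X (ix _ TT)) (ip_a (iy _ TT)).
  - exact: sqint_mul (ip_f (ix _ TT)) (ip_f (iy _ TT)).
have [h1 h2] := Rint_cut_time fi; split => // t tT.
have /andP[t0t _] := tT.
have [_ _ ->] := expected_product hw ht0 t0t (ix _ tT) (iy _ tT).
rewrite -h2//; congr (_ + _); by apply: eq_Rint => z; rewrite Ef.
Qed.

Definition running x u y v s om : K :=
  bil (Q s) (x s om) (y s om) + bil (R s) (u s om) (v s om).

Lemma int1_running x u y v : L2_adapted Pr w t0 T x -> adm u ->
  L2_adapted Pr w t0 T y -> adm v -> int1 nu (cut T (running x u y v)).
Proof.
move=> ax au ay av.
have i1 := int1_cut_bil hQ (fun i => L2_adapted_sqint i ax) (fun i => L2_adapted_sqint i ay).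
have i2 := int1_cut_bil hR (fun i => L2_adapted_sqint i au) (fun i => L2_adapted_sqint i av).
by apply: eq_int1 (int1D i1 i2) => r; rewrite /cut -mulrDl.
Qed.

(** Integrating P_ij E[x_i y_j] by parts and summing over i and j leaves the initial term and a time
    integral. Together with the running cost, its integrand at almost every time is the expectation
    of the expression in [completion], hence 0. *)
Lemma bilinear_identity (x0 y0 : 'cV[K]_n) u x v y (HT : 'M[K]_n) (P : K -> 'M[K]_n) :
  symmetric_on t0 T R -> symmetric_on t0 T P ->
  backward_ode t0 T (riccati L P) HT P -> regular L P t0 T ->
  adm u -> state x0 u x -> adm v -> state y0 v y ->
  (forall t, t0 <= t <= T -> {ae Pr, forall om,
     Upsilon L P t *m u t om + Gamma L P t *m x t om = 0}) ->
  \int[nu]_r cut T (running x u y v) r + \int[Pr]_om bil HT (x T om) (y T om) =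
  bil (P t0) x0 y0.
Proof.
move=> sR sP [iG hP] hreg au sx av sy hstat.
have [ax _ _] := sx; have [ay _ _] := sy.
have TT : t0 <= T <= T by rewrite htT lexx.
pose M i j t := \int[Pr]_om (coord x i t om * coord y j t om).
pose C := moment_rate x u y v.
pose G i j (s : measurableTypeR K) : K := riccati L P s i j.
have iNG i j : mu.-integrable `[t0, T] (EFin \o (fun s => - G i j s)).
  exact: integrableN (iG i j).
have hM i j := moment_primitive i j au sx av sy.
have hPij i j : forall t, t0 <= t <= T ->
    P t i j = P t0 i j + \int[mu]_(s in `[t0, t]) (- G i j s).
  by apply: backward_primitive (iG i j) _ => t tT; exact: hP.
have key i j := affine_primitive_mul (F := fun s => P s i j) (G := M i j)
  htT (iNG i j) (hM i j).1 (hPij i j) (hM i j).2.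
have PT : P T = HT.
  by apply/matrixP => i j; rewrite hP// set_itv1 Rintegral_set1 addr0.
have [iE hE] := Rint_cut_time (int1_running ax au ay av).
rewrite hE//.
have sxT i := state_final_sqint i au sx; have syT j := state_final_sqint j av sy.
rewrite (int1_bil HT sxT syT).2 -PT bil_sum.
have -> : \sum_i \sum_j P T i j * \int[Pr]_om (x T om i 0 * y T om j 0) =
  \sum_i \sum_j (P t0 i j * (x0 i 0 * y0 j 0)) + \sum_i \sum_j
    (\int[mu]_(s in `[t0, T]) (- G i j s * M i j s) +
     \int[mu]_(s in `[t0, T]) (P s i j * C i j s)).
  rewrite -big_split; apply: eq_bigr => i _; rewrite -big_split; apply: eq_bigr => j _.
  by have [_ _] := key i j.
rewrite addrCA -[RHS]addr0; congr (_ + _).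
pose H i j (s : measurableTypeR K) := - G i j s * M i j s + P s i j * C i j s.
have mD : measurable (`[t0, T]%classic : set (measurableTypeR K)) by exact: measurable_itv.
have iH i j : mu.-integrable `[t0, T] (EFin \o H i j).
  by have [k1 k2 _] := key i j; exact: (integrableD mD k1 k2).
have iHj i := (Rintegral_sum_on (index_enum 'I_n) mD (iH i)).1.
have [iHH eHH] := Rintegral_sum_on (index_enum 'I_n) mD iHj.
have -> : \sum_i \sum_j (\int[mu]_(s in `[t0, T]) (- G i j s * M i j s) +
     \int[mu]_(s in `[t0, T]) (P s i j * C i j s)) =
   \int[mu]_(s in `[t0, T]) \sum_i \sum_j H i j s.
  rewrite eHH; apply: eq_bigr => i _.
  rewrite (Rintegral_sum_on (index_enum 'I_n) mD (iH i)).2; apply: eq_bigr => j _.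
  by have [k1 k2 _] := key i j; rewrite -(RintegralD mD k1 k2).
rewrite -(RintegralD mD iE iHH).
have iZ := integrableD mD iE iHH.
rewrite /Rintegral (ae_eq_integral (cst 0%E))//; first by rewrite integral0.
  exact: (measurable_int _ iZ).
(* Expectations may be recombined only where all coordinates of x, u, y and v are square-integrable
   over Omega, which is the case for almost every s. *)
have ae4 := ae_and (ae_and (ae_sections (fun i => L2_adapted_sqint i ax))
    (ae_sections (fun i => L2_adapted_sqint i au)))
  (ae_and (ae_sections (fun i => L2_adapted_sqint i ay))
    (ae_sections (fun i => L2_adapted_sqint i av))).
apply: filterS ae4 => s [[h1 h2] [h3 h4]].
rewrite /= in_itv/= => st; congr EFin.
have {}h1 := h1 st; have {}h2 := h2 st; have {}h3 := h3 st; have {}h4 := h4 st.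
have hxu i := drift_sections h1 h2 i; have hyv i := drift_sections h3 h4 i.
have [i1 e1] := int1_bil (P s) (fun i => (hxu i).1) h3.
have [i2 e2] := int1_bil (P s) h1 (fun i => (hyv i).1).
have [i3 e3] := int1_bil (P s) (fun i => (hxu i).2) (fun i => (hyv i).2).
have [i4 e4] := int1_bil (riccati L P s) h1 h3.
have [i5 e5] := int1_bil (Q s) h1 h3.
have [i6 e6] := int1_bil (R s) h2 h4.
have -> : \sum_i \sum_j H i j s =
  \int[Pr]_om bil (P s) (drift x u s om) (y s om) +
  \int[Pr]_om bil (P s) (x s om) (drift y v s om) +
  \int[Pr]_om bil (P s) (diffusion x u s om) (diffusion y v s om) -
  \int[Pr]_om bil (riccati L P s) (x s om) (y s om).
  rewrite e1 e2 e3 e4 -!big_split -sumrB; apply: eq_bigr => i _.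
  rewrite -!big_split -sumrB; apply: eq_bigr => j _.
  have j1 := sqint_mul (hxu i).1 (h3 j); have j2 := sqint_mul (h1 i) (hyv j).1.
  have j3 := sqint_mul (hxu i).2 (hyv j).2.
  rewrite /H /C /moment_rate (RintD (int1D j1 j2) j3) (RintD j1 j2) /G /M /coord.
  by rewrite /=; ring.
rewrite /running -(RintD i1 i2) -(RintD (int1D i1 i2) i3).
rewrite -(RintB (int1D (int1D i1 i2) i3) i4).
rewrite -(RintD (int1D i5 i6) (int1B (int1D (int1D i1 i2) i3) i4)).
rewrite -[RHS](Rint0 Pr); apply: ae_eq_Rint => //.
  exact: int1_meas (int1D (int1D i5 i6) (int1B (int1D (int1D i1 i2) i3) i4)).
apply: filterS (hstat s st) => om h0.
have := completion (v s om) (y s om) (sP s st) (sR s st)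
  (regular_mpinv (hreg s st)) h0.
rewrite -/(drift x u s om) -/(drift y v s om) -/(diffusion x u s om) -/(diffusion y v s om).
by move=> e; apply: etrans e; ring.
Qed.

End LinearQuadratic.

(** * Differences of states and optimality *)

Section StateDifference.
Context {K : realType} {d : measure_display} {Omega : measurableType d}.
Variables (Pr : probability Omega K) (w : K -> Omega -> K) (t0 T : K).
Hypotheses (hw : brownian_motion Pr w) (ht0 : 0 <= t0) (htT : t0 <= T).
Local Notation mu := (@lebesgue_measure K).
Local Notation nu := (mu \x Pr)%E.
Local Notation cut := (cut t0).
Context {n m : nat}.
Variable L : lq_data K n m.
Hypotheses (hA : bounded_measurable t0 T (lqA L)) (hB : bounded_measurable t0 T (lqB L))
  (hAb : bounded_measurable t0 T (lqAb L)) (hBb : bounded_measurable t0 T (lqBb L))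
  (hQ : bounded_measurable t0 T (lqQ L)) (hR : bounded_measurable t0 T (lqR L)).
Local Notation adm := (admissible Pr w t0 T).
Local Notation state := (state L Pr w t0 T).
Implicit Types (x y : K -> Omega -> 'cV[K]_n) (u v : K -> Omega -> 'cV[K]_m).

Definition sub_proc p (x y : K -> Omega -> 'cV[K]_p) s om := x s om - y s om.

Lemma L2_adapted_sub p (x y : K -> Omega -> 'cV[K]_p) :
  L2_adapted Pr w t0 T x -> L2_adapted Pr w t0 T y ->
  L2_adapted Pr w t0 T (sub_proc x y).
Proof.
move=> ax ay; have sx i := L2_adapted_sqint i ax; have sy i := L2_adapted_sqint i ay.
move: ax ay => [mx wx _] [my wy _]; split.
- move=> i; rewrite (_ : (fun _ => _) =
      fun a : K * Omega => x a.1 a.2 i 0 - y a.1 a.2 i 0).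
    exact: measurable_funB.
  by apply/funext => a; rewrite /sub_proc !mxE.
- move=> t i tT; rewrite (_ : (fun _ => _) = fun om => x t om i 0 - y t om i 0).
    by apply: wrtB; [exact: wx|exact: wy].
  by apply/funext => om; rewrite /sub_proc !mxE.
have E : cut T (fun s om => sqnorm (sub_proc x y s om)) =
    fun r => \sum_i (cut T (coord x i) r - cut T (coord y i) r) ^+ 2.
  apply/funext => r; rewrite /cut sqnormE mulr_suml; apply: eq_bigr => i _.
  rewrite -mulrBl exprMn -natrX /sub_proc /coord !mxE.
  by case: (_ <= _ <= _).
have iS : int1 nu (cut T (fun s om => sqnorm (sub_proc x y s om))).
  by rewrite E; apply: int1_sum => i; exact: (sqintB (sx i) (sy i)).2.
rewrite ge0_iterated; last 2 first.
- by move=> s om; rewrite sqnormE sumr_ge0// => i _; exact: sqr_ge0.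
- exact: int1_meas iS.
exact: integrable_lty iS.
Qed.

Lemma state_sub (x0 y0 : 'cV[K]_n) u x v y : adm u -> state x0 u x ->
  adm v -> state y0 v y -> state (x0 - y0) (sub_proc u v) (sub_proc x y).
Proof.
move=> au sx av sy; have [ax cx rx] := sx; have [ay cy ry] := sy; split.
- exact: L2_adapted_sub.
- apply: filterS2 cx cy => om hx hy i.
  rewrite (_ : (fun t => _) = (fun t => x t om i 0 - y t om i 0)).
    by move=> r; apply: cvgB; [exact: hx|exact: hy].
  by apply/funext => t; rewrite /sub_proc !mxE.
move=> t i tT; have /andP[t0t tT'] := tT.
have px := state_ito_process hw ht0 hA hB hAb hBb i au sx tT.
have py := state_ito_process hw ht0 hA hB hAb hBb i av sy tT.
have [I iI hI] := rx t i tT; have [J iJ hJ] := ry t i tT.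
exists (fun om => I om - J om).
  rewrite (_ : (fun s om => _) = fun s om =>
    coord (diffusion L x u) i s om - coord (diffusion L y v) i s om).
    exact: ito_integralB t0t (ip_f px) (ip_f py) iI iJ.
  apply/funext => s; apply/funext => om.
  by rewrite /coord /diffusion /sub_proc !mulmxBr !mxE; ring.
have ia := int1_cut t0t (ip_a px); have ib := int1_cut t0t (ip_a py).
(* Splitting the drift integral of the difference takes integrable paths, which exist almost
   surely. *)
have hab : {ae Pr, forall om,
    \int[mu]_(s in `[t0, t])
      ((lqA L s *m sub_proc x y s om + lqB L s *m sub_proc u v s om) i 0) =
    \int[mu]_(s in `[t0, t]) ((lqA L s *m x s om + lqB L s *m u s om) i 0) -
    \int[mu]_(s in `[t0, t]) ((lqA L s *m y s om + lqB L s *m v s om) i 0)}.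
  apply: filterS2 (int1_ae_section2 ia) (int1_ae_section2 ib) => om ja jb.
  have e : primitive t0 (coord (drift L (sub_proc x y) (sub_proc u v)) i) t om =
      primitive t0 (coord (drift L x u) i) t om - primitive t0 (coord (drift L y v) i) t om.
    rewrite -!Rint_cut -(RintB ja jb); apply: eq_Rint => s.
    by rewrite -cutB /cut /coord /drift /sub_proc !mulmxBr !mxE; congr (_ * _); ring.
  exact: e.
apply: filterS3 hI hJ hab => om eI eJ eab.
by rewrite eab [LHS]mxE eI mxE eJ !mxE; ring.
Qed.

(** The extended-real cost of an admissible pair is finite, so costs can be compared by real
    arithmetic. *)
Lemma costE (x0 : 'cV[K]_n) u x : adm u -> state x0 u x ->
  cost L Pr t0 T x u = (\int[nu]_r cut T (running L x u x u) r +
    \int[Pr]_om bil (lqH L) (x T om) (x T om))%:E.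
Proof.
move=> au sx; have [ax _ _] := sx.
have [i1 <-] := Rint_primitive (int1_running hQ hR ax au ax au).
have sT i := state_final_sqint hw ht0 htT hA hB hAb hBb i au sx.
have [i2 _] := int1_bil (lqH L) sT sT.
rewrite /cost unlock EFinD; congr (_ + _)%E.
  by rewrite /Rintegral fineK; [|exact: (integrable_fin_num _ i1)].
by rewrite /Rintegral fineK; [|exact: (integrable_fin_num _ i2)].
Qed.

Lemma running_sub x u y v r :
  symmetric_on t0 T (lqQ L) -> symmetric_on t0 T (lqR L) ->
  cut T (running L (sub_proc y x) (sub_proc v u) (sub_proc y x) (sub_proc v u)) r =
  cut T (running L y v y v) r - 2 * cut T (running L x u y v) r +
  cut T (running L x u x u) r.
Proof.
move=> sQ sR; rewrite /cut; case: (boolP (t0 <= r.1 <= T)) => [rT|_]; last first.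
  by rewrite !mulr0 subr0 addr0.
rewrite !mulr1 /running /sub_proc !(bilDl, bilDr, bilNl, bilNr).
rewrite (bil_sym (y r.1 r.2) (x r.1 r.2) (sQ _ rT)).
rewrite (bil_sym (v r.1 r.2) (u r.1 r.2) (sR _ rT)); ring.
Qed.

Lemma stationary_optimal (x0 : 'cV[K]_n) u x (P1T : 'M[K]_n) (P : K -> 'M[K]_n) :
  symmetric_on t0 T (lqQ L) -> symmetric_on t0 T (lqR L) -> (lqH L)^T = lqH L ->
  (forall u x, adm u -> state 0 u x -> (0 <= cost L Pr t0 T x u)%E) ->
  P1T^T = P1T -> symmetric_on t0 T P ->
  backward_ode t0 T (riccati L P) (lqH L + P1T) P -> regular L P t0 T ->
  adm u -> state x0 u x ->
  (forall t, t0 <= t <= T -> {ae Pr, forall om,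
     Upsilon L P t *m u t om + Gamma L P t *m x t om = 0}) ->
  {ae Pr, forall om, P1T *m x T om = 0} ->
  cost L Pr t0 T x u = (quad (P t0) x0)%:E /\
  forall v y, adm v -> state x0 v y -> ((quad (P t0) x0)%:E <= cost L Pr t0 T y v)%E.
Proof.
move=> sQ sR sH hconv sP1 sP hP hreg au sx hstat hfin.
have [ax _ _] := sx.
have sxT i := state_final_sqint hw ht0 htT hA hB hAb hBb i au sx.
have Bxy v y : adm v -> state x0 v y ->
    \int[nu]_r cut T (running L x u y v) r + \int[Pr]_om bil (lqH L) (x T om) (y T om) =
    quad (P t0) x0.
  move=> av sy; rewrite quadE.
  rewrite -(bilinear_identity hw ht0 htT hA hB hAb hBb hQ hR sR sP hP hreg au sx av sy hstat).
  have syT i := state_final_sqint hw ht0 htT hA hB hAb hBb i av sy.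
  congr (_ + _); apply: ae_eq_Rint.
  - exact: int1_meas (int1_bil (lqH L) sxT syT).1.
  - exact: int1_meas (int1_bil (lqH L + P1T) sxT syT).1.
  - apply: filterS hfin => om h0; rewrite bilMD.
    (* Symmetry lets [P1T] act on x(T), where it gives 0, whatever y(T) is. *)
    have := bil_mull 1%:M P1T (x T om) (y T om).
    by rewrite h0 bil0l mulmx1 sP1 => <-; rewrite addr0.
split; first by rewrite (costE au sx); congr EFin; exact: Bxy.
move=> v y av sy; have [ay _ _] := sy.
have syT i := state_final_sqint hw ht0 htT hA hB hAb hBb i av sy.
have ad := L2_adapted_sub av au; have sd := state_sub av sy au sx.
rewrite subrr in sd.
have := hconv _ _ ad sd; rewrite (costE ad sd) (costE av sy) !lee_fin.
rewrite (eq_Rint _ (fun r => running_sub x u y v r sQ sR)).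
have iyy := int1_running hQ hR ay av ay av.
have ixy := int1_running hQ hR ax au ay av.
have ixx := int1_running hQ hR ax au ax au.
rewrite (RintD (int1B iyy (int1Z 2 ixy)) ixx) (RintB iyy (int1Z 2 ixy)) (RintZ 2 ixy).
have jyy := (int1_bil (lqH L) syT syT).1.
have jxy := (int1_bil (lqH L) sxT syT).1.
have jxx := (int1_bil (lqH L) sxT sxT).1.
have -> : \int[Pr]_om bil (lqH L) (sub_proc y x T om) (sub_proc y x T om) =
    \int[Pr]_om bil (lqH L) (y T om) (y T om) -
    2 * (\int[Pr]_om bil (lqH L) (x T om) (y T om)) +
    \int[Pr]_om bil (lqH L) (x T om) (x T om).
  rewrite -(RintZ 2 jxy) -(RintB jyy (int1Z 2 jxy)) -(RintD (int1B jyy (int1Z 2 jxy)) jxx).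
  apply: eq_Rint => om; rewrite /sub_proc !(bilDl, bilDr, bilNl, bilNr).
  by rewrite (bil_sym (y T om) (x T om) sH); ring.
have := Bxy _ _ av sy; have := Bxy _ _ au sx.
set a1 := \int[nu]_r _; set a2 := \int[Pr]_om _.
set a3 := \int[nu]_r _; set a4 := \int[Pr]_om _.
(* With c the common value of the form at (x, u; x, u) and (x, u; y, v), convexity reads 0 <= J(y,
   v) - 2 c + c. *)
move=> e1 e2; lra.
Qed.

End StateDifference.

(** The control dimension is written m0 + k so that the block splittings of the row reduction are
    well typed. That the formula gives the optimal controller is read both ways: such a controller
    exists, and every such controller is optimal, with any state it generates. *)
Theorem corollary2 (K : realType) (d : measure_display)
    (Omega : measurableType d) (Pr : probability Omega K)
    (w : K -> Omega -> K) (t0 T : K)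
    (n m0 k : nat) (L : lq_data K n (m0 + k)) (x0 : 'cV[K]_n)
    (P1T : 'M[K]_n) (P P1 Pbar : K -> 'M[K]_n) (T0 : K -> 'M[K]_(m0 + k))
    (* time horizon, noise, coefficients *)
    (ht0 : 0 <= t0) (htT : t0 < T) (hw : brownian_motion Pr w)
    (hA : bounded_measurable t0 T (lqA L))
    (hB : bounded_measurable t0 T (lqB L))
    (hAb : bounded_measurable t0 T (lqAb L))
    (hBb : bounded_measurable t0 T (lqBb L))
    (hQ : bounded_measurable t0 T (lqQ L))
    (hR : bounded_measurable t0 T (lqR L))
    (sQ : symmetric_on t0 T (lqQ L)) (sR : symmetric_on t0 T (lqR L))
    (sH : (lqH L)^T = lqH L)
    (* convexity *)
    (hconv : forall u x, admissible Pr w t0 T u -> state L Pr w t0 T 0 u x ->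
       (0 <= cost L Pr t0 T x u)%E)
    (* P, P1, Pbar *)
    (sP : symmetric_on t0 T P)
    (hP : backward_ode t0 T (riccati L P) (lqH L) P)
    (sP1T : P1T^T = P1T) (sP1 : symmetric_on t0 T P1)
    (hP1 : backward_ode t0 T (riccati1 L P P1) P1T P1)
    (sPbar : symmetric_on t0 T Pbar)
    (hPbar : backward_ode t0 T (riccati L Pbar) (lqH L + P1T) Pbar)
    (* rank Upsilon0 = m0 < m = m0 + k, and the row transformation T0 *)
    (hk : (0 < k)%N)
    (hrank : forall t, t0 <= t <= T -> \rank (Upsilon L P t) = m0)
    (hT0 : forall t, t0 <= t <= T -> row_reduction L P t (T0 t))
    (* (a) *)
    (ha1 : forall t, t0 <= t <= T ->
       let N := mpinv (IP1F L P P1 t) *m IP1F L P P1 t in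
       [/\ (lqB L t)^T = (lqB L t)^T *m N,
           (lqAb L t)^T = (lqAb L t)^T *m N &
           (lqBb L t)^T = (lqBb L t)^T *m N])
    (ha2 : forall t, t0 <= t <= T ->
       let Bb := lqBb L t in
       let S := mpinv (Upsilon L P t + Bb^T *m P1 t *m Bb) in
       let Yd := mpinv (Upsilon L P t) in
       let N := 1%:M - Yd *m Bb^T *m mpinv (IP1F L P P1 t) *m P1 t *m Bb in
       S *m (lqB L t)^T = N *m Yd *m (lqB L t)^T /\
       S *m Bb^T = N *m Yd *m Bb^T)
    (ha3 : forall t, t0 <= t <= T ->
       0 = (Bb0 L P t (T0 t))^T *m mpinv (IP1F L P P1 t) *m P1 t *m
           Bb0 L P t (T0 t))
    (* (b) *)
    (hb : regular L Pbar t0 T)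
    (* (c) *)
    (hc : exists z u x,
       [/\ feedback_form L Pbar Pr t0 T x z u,
           minimizes L Pr w t0 T (changed_cost L Pr t0 T P1T) x0 x u &
           {ae Pr, forall om, P1T *m x T om = 0}]) :
  let stated z u x :=
    [/\ admissible Pr w t0 T u, state L Pr w t0 T x0 u x,
        feedback_form L Pbar Pr t0 T x z u &
        {ae Pr, forall om, P1T *m x T om = 0}] in
  [/\ exists z u x, stated z u x,
      forall z u x, stated z u x ->
        minimizes L Pr w t0 T (cost L Pr t0 T) x0 x u /\
        cost L Pr t0 T x u = (quad (Pbar t0) x0)%:E &
      optimal_cost L Pr w t0 T x0 = (quad (Pbar t0) x0)%:E].
Proof.
move=> stated; have t0T := ltW htT.
have stat z u x : feedback_form L Pbar Pr t0 T x z u ->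
    forall t, t0 <= t <= T -> {ae Pr, forall om,
      Upsilon L Pbar t *m u t om + Gamma L Pbar t *m x t om = 0}.
  move=> hf t tT; apply: filterS (hf t tT) => om.
  by apply: feedback_stationary; apply: regular_mpinv; exact: hb.
have opt z u x : stated z u x ->
    cost L Pr t0 T x u = (quad (Pbar t0) x0)%:E /\
    forall v y, admissible Pr w t0 T v -> state L Pr w t0 T x0 v y ->
      ((quad (Pbar t0) x0)%:E <= cost L Pr t0 T y v)%E.
  move=> [au sx hf hfin].
  exact: (stationary_optimal hw ht0 t0T hA hB hAb hBb hQ hR sQ sR sH hconv sP1T
    sPbar hPbar hb au sx (stat z u x hf) hfin).
(* The controller granted by (c) is itself of the stated kind, so it shows existence and attains the
   infimum. *)
have [z [u [x [hf [au sx _] hfin]]]] := hc.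
have ex : stated z u x by split.
split.
- by exists z, u, x.
- move=> z' u' x' st; have [e le] := opt _ _ _ st; have [au' sx' _ _] := st.
  by split => //; split => // v y av sy; rewrite e; exact: le.
have [e le] := opt _ _ _ ex; apply/le_anti/andP; split.
  by rewrite -e; apply: ereal_inf_lbound; exists u, x.
by apply: le_ereal_inf_tmp => c [v [y [av sy ->]]]; exact: le.
Qed.
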